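(* Let $n_1,n_2$ be positive integers and let $l,u\in\mathbb{R}^{n_1}$ (in particular every $u_i$ is finite) satisfy $0\le l_i\le u_i$ for all $i\in[n_1]$. Let $$\mathcal{U}^{\mathrm{row}}:=\left\{W\in\mathbb{R}^{n_1\times n_2}_{+}\ \middle|\ l_i\le\sum_{j=1}^{n_2}W_{ij}\le u_i\ \ \forall i\in[n_1],\ \operatorname{rank}(W)\le 1\right\}.$$ Then the following hold. 1. $\operatorname{conv}(\mathcal{U}^{\mathrm{row}})$ is a polyhedral set. 2. A compact extended formulation of $\operatorname{conv}(\mathcal{U}^{\mathrm{row}})$ is given by the following system in the variables $(t,W)\in\mathbb{R}^{n_2}\times\mathbb{R}^{n_1\times n_2}$ (that is, $\operatorname{conv}(\mathcal{U}^{\mathrm{row}})$ is the projection of its solution set onto the $W$ variables): $$\sum_{j=1}^{n_2}t_j=1,\qquad l_it_j\le W_{ij}\le u_it_j\ \ \forall i\in[n_1],\,j\in[n_2],\qquad t_j\ge 0\ \ \forall j\in[n_2].$$ Therefore, a linear function can be optimized in polynomial time over $\mathcal{U}^{\mathrm{row}}$. 3. Let $\mathcal{I}:=\{i\in[n_1]\mid l_i>0\}$, where without loss of generality (reordering rows) $\mathcal{I}=\{1,\dots,|\mathcal{I}|\}$, and assume $u_i>0$ for all $i\in[n_1]$. Then $\operatorname{conv}(\mathcal{U}^{\mathrm{row}})$ is the set of all $W\in\mathbb{R}^{n_1\times n_2}$ satisfying $$\text{(a)}\quad \sum_{i=1}^{n_1}\sum_{j\in T_i}\frac{W_{ij}}{u_i}\le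 1\qquad\forall (T_1,\dots,T_{n_1})\in\mathcal{P}_{n_1}([n_2]),$$ $$\text{(b)}\quad \sum_{i\in\mathcal{I}}\sum_{j\in T_i}\frac{W_{ij}}{l_i}\ge 1\qquad\forall (T_1,\dots,T_{|\mathcal{I}|})\in\mathcal{P}_{|\mathcal{I}|}([n_2]),$$ $$\text{(c)}\quad l_{i_1}W_{i_2j}\le u_{i_2}W_{i_1j}\qquad\forall j\in[n_2],\ i_1\in\mathcal{I},\ i_2\in[n_1],\ i_1\ne i_2,$$ $$\text{(d)}\quad W_{ij}\ge 0\qquad\forall i\in[n_1],\,j\in[n_2],$$ where the family (b) is omitted if $\mathcal{I}=\emptyset$. Moreover, the inequalities (a) and the inequalities (b) can be separated in polynomial time.
   Context: $[n]=\{1,\dots,n\}$; $\mathbb{R}^{n_1\times n_2}_+$ is the set of entrywise nonnegative matrices; $\operatorname{conv}(S)$ is the convex hull of $S$. For a finite set $S$, $\mathcal{P}_m(S)$ is the set of ordered $m$-tuples $(S_1,\dots,S_m)$ of pairwise disjoint (possibly empty) subsets of $S$ with $\bigcup_{k=1}^mS_k=S$. ''Compact'' means of size polynomial in $n_1,n_2$. ''Separated in polynomial time'' means that there is a polynomial-time algorithm which, given a matrix $\hat W$, either finds an inequality of the family violated by $\hat W$ or certifies that $\hat W$ satisfies all of them. ''Polynomial time'' is in the size of the (rational) input data. *)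

(* Defs.v *)
From mathcomp Require Import all_boot all_order all_algebra.
From mathcomp Require Import classical_sets reals.

Set Implicit Arguments.
Unset Strict Implicit.
Unset Printing Implicit Defensive.

Import Order.TTheory GRing.Theory Num.Theory.

Local Open Scope ring_scope.

(* The index set [n] is 'I_n; l and u are column vectors, t is a row vector. *)

Definition conv (R : realFieldType) (V : lmodType R) (S : set V) : set V :=
  fun x => exists (m : nat) (a : 'I_m -> R) (v : 'I_m -> V),
    [/\ forall k, 0 <= a k, \sum_k a k = 1, forall k, S (v k)
      & x = \sum_k a k *: v k].

(* Linear constraints in variables indexed by V; a linear form is the vector
   of its coefficients, and [lterm a v] is the form a * v. *)
Inductive lincon (R : realFieldType) (V : finType) : Type :=
  | LinEq of {ffun V -> R} & R
  | LinLe of {ffun V -> R} & R.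

Definition lterm (R : realFieldType) (V : finType) (a : R) (v : V) :
    {ffun V -> R} := [ffun w => if w == v then a else 0].

Definition lform (R : realFieldType) (V : finType) (f : {ffun V -> R})
    (x : V -> R) : R := \sum_v f v * x v.

Definition lincon_holds (R : realFieldType) (V : finType) (x : V -> R)
    (c : lincon R V) : bool :=
  match c with
  | LinEq f b => lform f x == b
  | LinLe f b => lform f x <= b
  end.

Definition satisfies (R : realFieldType) (V : finType) (sys : seq (lincon R V))
    (x : V -> R) : bool := all (lincon_holds x) sys.

(* The number of entries of the augmented coefficient matrix. *)
Definition system_size (R : realFieldType) (V : finType)
    (sys : seq (lincon R V)) : nat := (size sys * #|V|.+1)%N.

Definition polyhedral (R : realFieldType) (n1 n2 : nat)
    (S : set 'M[R]_(n1, n2)) : Prop :=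
  exists sys : seq (lincon R ('I_n1 * 'I_n2)%type),
    forall W, S W <-> satisfies sys (fun v => W v.1 v.2).

Definition row_bounds (R : realFieldType) (n1 : nat) (l u : 'cV[R]_n1) : Prop :=
  forall i, 0 <= l i 0 <= u i 0.

Definition Urow (R : realFieldType) (n1 n2 : nat) (l u : 'cV[R]_n1) :
    set 'M[R]_(n1, n2) :=
  fun W => [/\ forall i j, 0 <= W i j,
               forall i, l i 0 <= \sum_j W i j <= u i 0
             & (\rank W <= 1)%N].

Definition row_ext (R : realFieldType) (n1 n2 : nat) (l u : 'cV[R]_n1)
    (t : 'rV[R]_n2) (W : 'M[R]_(n1, n2)) : Prop :=
  [/\ \sum_j t 0 j = 1,
      forall i j, l i 0 * t 0 j <= W i j <= u i 0 * t 0 j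
    & forall j, 0 <= t 0 j].

(* [row_ext] as an explicit list of linear constraints, so that its size can
   be measured. *)
Section ExtendedSystem.
Variables (R : realFieldType) (n1 n2 : nat).

Definition ext_var : finType := ('I_n2 + 'I_n1 * 'I_n2)%type.

Definition ext_point (t : 'rV[R]_n2) (W : 'M[R]_(n1, n2)) (v : ext_var) : R :=
  match v with inl j => t 0 j | inr ij => W ij.1 ij.2 end.

Let tvar (j : 'I_n2) : ext_var := inl j.
Let Wvar (i : 'I_n1) (j : 'I_n2) : ext_var := inr (i, j).

Definition row_ext_system (l u : 'cV[R]_n1) : seq (lincon R ext_var) :=
  LinEq (\sum_j lterm 1 (tvar j)) 1
  :: [seq LinLe (lterm (l i 0) (tvar j) - lterm 1 (Wvar i j)) 0
       | i <- enum 'I_n1, j <- enum 'I_n2]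
  ++ [seq LinLe (lterm 1 (Wvar i j) - lterm (u i 0) (tvar j)) 0
       | i <- enum 'I_n1, j <- enum 'I_n2]
  ++ [seq LinLe (- lterm 1 (tvar j)) 0 | j <- enum 'I_n2].

End ExtendedSystem.

(* P_m(S): the parts may be empty. *)
Definition ordered_partitions (X : finType) (m : nat) (S : {set X}) :
    {set {ffun 'I_m -> {set X}}} :=
  [set T : {ffun 'I_m -> {set X}} |
    [forall k, forall k', (k != k') ==> [disjoint T k & T k']]
    && (\bigcup_k T k == S)].

Definition pos_rows (R : realFieldType) (n1 : nat) (l : 'cV[R]_n1) :
    {set 'I_n1} := [set i | 0 < l i 0].

Definition ineq_a (R : realFieldType) (n1 n2 : nat) (u : 'cV[R]_n1)
    (W : 'M[R]_(n1, n2)) (T : {ffun 'I_n1 -> {set 'I_n2}}) : bool :=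
  \sum_i \sum_(j in T i) W i j / u i 0 <= 1.

(* [enum_val k] is the k-th smallest positive row, that is, row k itself when
   the positive rows come first. *)
Definition ineq_b (R : realFieldType) (n1 n2 : nat) (l : 'cV[R]_n1)
    (W : 'M[R]_(n1, n2)) (T : {ffun 'I_#|pos_rows l| -> {set 'I_n2}}) : bool :=
  1 <= \sum_(k < #|pos_rows l|)
         \sum_(j in T k) W (enum_val k) j / l (enum_val k) 0.

(* WHILE programs over integers under the logarithmic cost criterion.  The
   memory consists of arrays of integers, named by natural numbers fixed in
   the program text and indexed by computed values (up to sign).  Every
   evaluation of an expression node costs the binary length of its value, so
   an operation is charged for its operands as well as for its result; these
   costs are polynomially related to Turing machine time. *)

Definition store := nat -> nat -> int.

Inductive expr : Type :=
  | ELit of int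
  | EGet of nat & expr
  | EAdd of expr & expr
  | ESub of expr & expr
  | EMul of expr & expr.

Inductive cmd : Type :=
  | CSkip
  | CSet of nat & expr & expr     (* array, index, value *)
  | CEmit of expr
  | CSeq of cmd & cmd
  | CIf of expr & cmd & cmd        (* tests whether the value is positive *)
  | CWhile of expr & cmd.

(* One sign bit and the binary digits of the absolute value. *)
Definition bitsize (z : int) : nat := (trunc_log 2 `|z|%N).+2.

Fixpoint eval (s : store) (e : expr) : int :=
  match e with
  | ELit z => z
  | EGet a e1 => s a `|eval s e1|%N
  | EAdd e1 e2 => eval s e1 + eval s e2
  | ESub e1 e2 => eval s e1 - eval s e2
  | EMul e1 e2 => eval s e1 * eval s e2
  end.

Fixpoint ecost (s : store) (e : expr) : nat :=
  (bitsize (eval s e) +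
   match e with
   | ELit _ => 0
   | EGet _ e1 => ecost s e1
   | EAdd e1 e2 | ESub e1 e2 | EMul e1 e2 => ecost s e1 + ecost s e2
   end)%N.

Definition update (s : store) (a i : nat) (z : int) : store :=
  fun b j => if (b == a) && (j == i) then z else s b j.

(* [exec c s s' out t]: started in s, the program c halts in s' after emitting
   the list out, at total cost t. *)
Inductive exec : cmd -> store -> store -> seq int -> nat -> Prop :=
  | ExSkip s : exec CSkip s s [::] 1
  | ExSet s a e1 e2 :
      exec (CSet a e1 e2) s (update s a `|eval s e1|%N (eval s e2)) [::]
        (ecost s e1 + ecost s e2).+1%N
  | ExEmit s e : exec (CEmit e) s s [:: eval s e] (ecost s e).+1
  | ExSeq c1 c2 s1 s2 s3 o1 o2 t1 t2 :
      exec c1 s1 s2 o1 t1 -> exec c2 s2 s3 o2 t2 ->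
      exec (CSeq c1 c2) s1 s3 (o1 ++ o2) (t1 + t2)%N
  | ExIfTrue e c1 c2 s s' o t :
      0 < eval s e -> exec c1 s s' o t ->
      exec (CIf e c1 c2) s s' o (ecost s e + t).+1%N
  | ExIfFalse e c1 c2 s s' o t :
      eval s e <= 0 -> exec c2 s s' o t ->
      exec (CIf e c1 c2) s s' o (ecost s e + t).+1%N
  | ExWhileTrue e c s1 s2 s3 o1 o2 t1 t2 :
      0 < eval s1 e -> exec c s1 s2 o1 t1 -> exec (CWhile e c) s2 s3 o2 t2 ->
      exec (CWhile e c) s1 s3 (o1 ++ o2) (ecost s1 e + t1 + t2).+1%N
  | ExWhileFalse e c s :
      eval s e <= 0 -> exec (CWhile e c) s s [::] (ecost s e).+1.

(* The input list is stored in array 0; all other cells contain 0. *)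
Definition init_store (x : seq int) : store :=
  fun a i => if a == 0%N then nth 0 x i else 0.

Definition input_size (x : seq int) : nat := (\sum_(z <- x) bitsize z)%N.

(* The search problem "given a valid x, find out such that sol x out". *)
Definition polytime_solvable (X : Type) (valid : X -> Prop)
    (enc : X -> seq int) (sol : X -> seq int -> Prop) : Prop :=
  exists (c : cmd) (p : {poly nat}), forall x, valid x ->
    exists (s : store) (out : seq int) (t : nat),
      [/\ exec c (init_store (enc x)) s out t,
          (t <= p.[input_size (enc x)])%N
        & sol x out].

(* A rational is given by its reduced numerator and denominator, a matrix by
   its entries in row-major order. *)
Definition enc_rat (q : rat) : seq int := [:: numq q; denq q].

Definition enc_mx (m n : nat) (A : 'M[rat]_(m, n)) : seq int :=
  flatten [seq enc_rat (A i j) | i <- enum 'I_m, j <- enum 'I_n].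

(* A tuple of subsets of [n] is given by its 0/1 incidence matrix. *)
Definition enc_sets (m n : nat) (T : {ffun 'I_m -> {set 'I_n}}) : seq int :=
  [seq (j \in T i)%:R | i <- enum 'I_m, j <- enum 'I_n].

(* [row_mat] is the objective in the optimization problem and the matrix to
   be separated in the separation problems. *)
Record row_data : Type := RowData {
  nrow : nat;
  ncol : nat;
  row_lo : 'cV[rat]_nrow;
  row_up : 'cV[rat]_nrow;
  row_mat : 'M[rat]_(nrow, ncol) }.

Definition enc_row_data (d : row_data) : seq int :=
  [:: Posz (nrow d), Posz (ncol d)
    & enc_mx (row_lo d) ++ enc_mx (row_up d) ++ enc_mx (row_mat d)].

Definition valid_row_data (d : row_data) : Prop :=
  [/\ (0 < nrow d)%N, (0 < ncol d)%N & row_bounds (row_lo d) (row_up d)].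

Definition valid_row_data_pos (d : row_data) : Prop :=
  valid_row_data d /\ forall i, 0 < row_up d i 0.

Definition linfun_mx (R : realFieldType) (m n : nat) (C W : 'M[R]_(m, n)) : R :=
  \sum_i \sum_j C i j * W i j.

(* The output is an optimal point of the real feasible set with rational
   entries. *)
Definition row_optimum (R : realFieldType) (maximize : bool) (d : row_data)
    (out : seq int) : Prop :=
  let l := map_mx (ratr : rat -> R) (row_lo d) in
  let u := map_mx (ratr : rat -> R) (row_up d) in
  let C := map_mx (ratr : rat -> R) (row_mat d) in
  exists W : 'M[rat]_(nrow d, ncol d),
    let W' := map_mx (ratr : rat -> R) W in
    [/\ Urow l u W',
        forall V, Urow l u V ->
          if maximize then linfun_mx C V <= linfun_mx C W'
          else linfun_mx C W' <= linfun_mx C V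
      & out = enc_mx W].

(* The output is 0 if all inequalities hold, and otherwise 1 followed by the
   index of a violated one. *)
Definition separation (m n : nat) (ineq : {ffun 'I_m -> {set 'I_n}} -> bool)
    (out : seq int) : Prop :=
  (out = [:: 0] /\
     forall T, T \in ordered_partitions m [set: 'I_n] -> ineq T)
  \/ exists T, [/\ T \in ordered_partitions m [set: 'I_n], ~~ ineq T
                 & out = 1 :: enc_sets T].

Definition separation_a (d : row_data) : seq int -> Prop :=
  separation (ineq_a (row_up d) (row_mat d)).

Definition separation_b (d : row_data) : seq int -> Prop :=
  separation (@ineq_b _ _ _ (row_lo d) (row_mat d)).

(* Main.v *)
Require Import Defs.
From mathcomp Require Import all_boot all_order all_algebra.
From mathcomp Require Import classical_sets reals.
From mathcomp Require Import ring lra zify.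

(** A rank-one nonnegative matrix is [W i j = r i * t j] with [t] in the
    simplex, so it satisfies the extended system; conversely a solution [(t, W)]
    is the convex combination, with weights [t j], of matrices supported on the
    single column [j].  Eliminating [t] leaves, for each column, the interval
    [max_i W i j / u i <= t j <= min_i W i j / l i] together with
    [\sum_j t j = 1]; choosing a row for each column linearizes the sums of the
    maxima and of the minima.

    A linear function is thus optimized by a single column with entries [l i] or
    [u i], according to the sign of the objective, and the most violated
    inequality of each exponential family is found by optimizing the row column
    by column.  Both algorithms compare fractions by cross-multiplication and
    never reduce them: adding [n] fractions with numerators and denominators of
    [b] bits gives [O(n b)] bits. *)

Set Implicit Arguments.
Unset Strict Implicit.
Unset Printing Implicit Defensive.

Import Order.TTheory GRing.Theory Num.Theory.
Local Open Scope ring_scope.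

(** * Convex hull *)

(** Eliminating [t] needs no general projection argument: once the lower ends of the intervals sum
    to at most one and the upper ends to at least one, some point of the segment joining the two
    vectors of ends sums to one. Degenerate data shape the statements. A row with [u i 0 = 0] has to
    be forced to vanish by a family of its own, and when no [l i 0] is positive there is no upper
    end at all.

    For the complexity claims the obstacle is the length of the numbers: a loop that multiplies
    could double lengths at each round, so counting steps is not enough. Every cell is shown to stay
    below [2 ^ L] with [L] quadratic in the input size [S]; a quadratic number of steps then gives a
    time bound of degree four.

    A sign [sg] lets one program do two jobs. It turns minimization into maximization, and it
    rewrites the inequalities (b) as upper bounds by -1 on sums of terms [- W i j / l i 0], the
    shape that (a) has with bound 1. *)

Section LinearForms.
Variables (R : realFieldType) (V : finType).

Lemma lform_lterm (a : R) (v : V) (x : V -> R) : lform (lterm a v) x = a * x v.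
Proof.
rewrite /lform (bigD1 v) //= big1 => [|w /negPf vw]; rewrite !ffunE ?eqxx ?addr0 //.
by rewrite vw mul0r.
Qed.

Lemma lform0 (x : V -> R) : lform 0 x = 0.
Proof. by rewrite /lform big1 // => v _; rewrite ffunE mul0r. Qed.

Lemma lformD (f g : {ffun V -> R}) (x : V -> R) :
  lform (f + g) x = lform f x + lform g x.
Proof. by rewrite /lform -big_split; apply: eq_bigr => v _; rewrite ffunE mulrDl. Qed.

Lemma lformN (f : {ffun V -> R}) (x : V -> R) : lform (- f) x = - lform f x.
Proof. by rewrite /lform -sumrN; apply: eq_bigr => v _; rewrite ffunE mulNr. Qed.

Lemma lform_sum (I : Type) (r : seq I) (F : I -> {ffun V -> R}) (x : V -> R) :
  lform (\sum_(i <- r) F i) x = \sum_(i <- r) lform (F i) x.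
Proof. by elim/big_rec2: _ => [|i y f _ <-]; rewrite ?lform0 // lformD. Qed.

Lemma satisfies_cat (s1 s2 : seq (lincon R V)) (x : V -> R) :
  satisfies (s1 ++ s2) x <-> satisfies s1 x /\ satisfies s2 x.
Proof. by rewrite /satisfies all_cat; apply: (iff_sym (rwP andP)). Qed.

Lemma satisfies_filter (T : finType) (P : pred T) (c : T -> lincon R V) (x : V -> R) :
  reflect (forall t, P t -> lincon_holds x (c t))
    (satisfies [seq c t | t <- enum T & P t] x).
Proof.
rewrite /satisfies all_map all_filter.
apply: (iffP allP) => h t; last by move=> _; apply/implyP/h.
by apply/implyP/h; rewrite mem_enum.
Qed.

End LinearForms.

(** * The hull, its extended formulation and its linear inequalities *)

Section RowHull.
Variables (R : realFieldType) (n1 n2 : nat) (l u : 'cV[R]_n1).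
Hypothesis lu : row_bounds l u.

(** In the factorization [col_base W *m row_base W] the inner dimension is the rank, so each entry
    is zero or a single product. *)
Lemma rank_le1_minor (W : 'M[R]_(n1, n2)) i i' j j' :
  (\rank W <= 1)%N -> W i j * W i' j' = W i j' * W i' j.
Proof.
rewrite -{2 3 4 5}(mulmx_base W) !mxE.
move: (col_base W) (row_base W); case: (\rank W) => [|[|//]] A B _.
  by rewrite !big_ord0 !mul0r.
by rewrite !big_ord1; ring.
Qed.

(** Any row with nonzero sum, divided by that sum, serves as [t]: vanishing minors make every other
    row the multiple of it given by its own row sum, which lies between [l] and [u]. *)
Lemma Urow_row_ext (W : 'M[R]_(n1, n2)) : (0 < n2)%N ->
  Urow l u W -> exists t, row_ext l u t W.
Proof.
move=> n2_gt0 [W_ge0 Wlu rkW].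
pose r i := \sum_j W i j.
have r_ge0 i : 0 <= r i by apply: sumr_ge0.
case: (pickP (fun i => r i != 0)) => [i0 ri0|r0].
  have r_gt0 : 0 < r i0 by rewrite lt_def ri0 r_ge0.
  exists (\row_j (W i0 j / r i0)); split.
  - under eq_bigr do rewrite mxE.
    by rewrite -mulr_suml divff.
  - move=> i j; rewrite mxE.
    have -> : W i j = r i * (W i0 j / r i0).
      apply: (mulIf ri0); rewrite -mulrA divfK // /r mulr_sumr mulr_suml.
      by apply: eq_bigr => k _; rewrite (rank_le1_minor _ _ _ _ rkW).
    have /andP[lr ru] := Wlu i.
    have t0 : 0 <= W i0 j / r i0 by rewrite divr_ge0.
    by rewrite !ler_wpM2r.
  - by move=> j; rewrite mxE divr_ge0.
(* All row sums vanish, hence [W = 0] and every [l i 0] is at most 0: a vertex of the simplex will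
   do. *)
have W0 i j : W i j = 0.
  have := r0 i; move/negbFE; rewrite /r psumr_eq0 // => /allP h.
  by apply/eqP/(h j); rewrite mem_index_enum.
exists (\row_j if j == Ordinal n2_gt0 then 1 else 0); split.
- by under eq_bigr do rewrite mxE; rewrite -big_mkcond big_pred1_eq.
- move=> i j; rewrite mxE W0.
  have := Wlu i; rewrite -/(r i); move/negbFE/eqP: (r0 i) => ->.
  case/andP=> l_le0 u_ge0; case: eqP => _; rewrite ?mulr1 ?mulr0 ?lexx //.
  by apply/andP.
- by move=> j; rewrite mxE; case: eqP.
Qed.

Definition column_mx (j : 'I_n2) (v : 'I_n1 -> R) : 'M[R]_(n1, n2) :=
  \matrix_(i, k) if k == j then v i else 0.

Lemma column_mx_Urow j v : (forall i, l i 0 <= v i <= u i 0) -> Urow l u (column_mx j v).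
Proof.
move=> vlu; split.
- move=> i k; rewrite mxE; case: eqP => // _.
  by case/andP: (vlu i) (lu i) => lv _ /andP[l0 _]; apply: le_trans lv.
- move=> i; under eq_bigr do rewrite mxE.
  by rewrite -big_mkcond big_pred1_eq.
- have -> : column_mx j v = (\col_i v i) *m delta_mx 0 j.
    apply/matrixP => i k; rewrite !mxE big_ord1 !mxE eqxx.
    by case: eqP; rewrite ?mulr1 ?mulr0.
  by apply: leq_trans (mxrankM_maxr _ _) _; rewrite mxrank_delta.
Qed.

Lemma row_ext_conv t (W : 'M[R]_(n1, n2)) : row_ext l u t W -> conv (Urow l u) W.
Proof.
case=> t1 Wt t0.
(* If [t 0 j = 0], column [j] of [W] vanishes and its generator has weight zero, but that generator
   must still be feasible; [l] is a feasible choice. *)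
pose v j i := if t 0 j == 0 then l i 0 else W i j / t 0 j.
exists n2, (t 0), (fun j => column_mx j (v j)); split=> //.
  move=> j; apply: column_mx_Urow => i; rewrite /v.
  case: eqP => [_|/eqP tj]; first by case/andP: (lu i) => _ ->; rewrite lexx.
  have tj_gt0 : 0 < t 0 j by rewrite lt_def tj t0.
  by rewrite ler_pdivlMr // ler_pdivrMr.
apply/matrixP => i j; rewrite summxE (bigD1 j) //= big1 => [|k /negPf kj].
  rewrite !mxE eqxx addr0 /v; case: eqP => [tj|/eqP tj].
    by have := Wt i j; rewrite tj !mulr0 mul0r => /le_anti.
  by rewrite mulrC divfK.
by rewrite !mxE eq_sym kj mulr0.
Qed.

(** The extended system is linear, so the weights that combine the matrices also combine their
    witnesses [t]. *)
Lemma conv_row_ext (W : 'M[R]_(n1, n2)) : (0 < n2)%N ->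
  conv (Urow l u) W <-> exists t, row_ext l u t W.
Proof.
move=> n2_gt0; split=> [|[t]]; last exact: row_ext_conv.
case=> m [a] [V] [a0 a1 UV ->].
have [t tV] : exists t : 'I_m -> 'rV_n2, forall k, row_ext l u (t k) (V k).
  have /fin_all_exists //= : forall k, exists t, row_ext l u t (V k).
  by move=> k; apply: Urow_row_ext.
exists (\sum_k a k *: t k); split.
- under eq_bigr do rewrite summxE.
  rewrite exchange_big /= -[RHS]a1; apply: eq_bigr => k _.
  under eq_bigr do rewrite mxE.
  by rewrite -mulr_sumr; case: (tV k) => -> _ _; rewrite mulr1.
- move=> i j; rewrite !summxE !mulr_sumr; apply/andP; split; apply: ler_sum => k _;
    rewrite !mxE mulrCA ler_wpM2l //; by case: (tV k) => _ /(_ i j)/andP[].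
- move=> j; rewrite summxE sumr_ge0 // => k _.
  by rewrite mxE mulr_ge0 //; case: (tV k).
Qed.

(* [x / 0 = 0] makes the rows with [u i 0 = 0] harmless in the first family. *)
Lemma conv_row_ineqs (W : 'M[R]_(n1, n2)) : (0 < n1)%N -> (0 < n2)%N ->
  conv (Urow l u) W <->
  [/\ forall f : {ffun 'I_n2 -> 'I_n1}, \sum_j W (f j) j / u (f j) 0 <= 1,
      forall f : {ffun 'I_n2 -> 'I_n1}, (forall j, 0 < l (f j) 0) ->
        1 <= \sum_j W (f j) j / l (f j) 0,
      forall j i1 i2, 0 < l i1 0 -> l i1 0 * W i2 j <= u i2 0 * W i1 j,
      forall i j, 0 <= W i j
    & forall i j, u i 0 = 0 -> W i j <= 0].
Proof.
move=> n1_gt0 n2_gt0; rewrite conv_row_ext //.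
have l0 i : 0 <= l i 0 by case/andP: (lu i).
have u0 i : 0 <= u i 0 by case/andP: (lu i); apply: le_trans.
have u_gt0 i : u i 0 != 0 -> 0 < u i 0 by rewrite lt_def u0 andbT.
split=> [[t [t1 Wt t0]]|[Wa Wb Wc W0 Wu]].
  have Wl i j : l i 0 * t 0 j <= W i j by case/andP: (Wt i j).
  have Wu i j : W i j <= u i 0 * t 0 j by case/andP: (Wt i j).
  have W0 i j : 0 <= W i j by apply: le_trans (Wl i j); rewrite mulr_ge0.
  split=> //.
  - move=> f; rewrite -t1; apply: ler_sum => j _.
    have [->|nz] := eqVneq (u (f j) 0) 0; first by rewrite invr0 mulr0.
    by rewrite ler_pdivrMr ?u_gt0 // mulrC.
  - move=> f lf; rewrite -t1; apply: ler_sum => j _.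
    by rewrite ler_pdivlMr // mulrC.
  - move=> j i1 i2 _; apply: (@le_trans _ _ (l i1 0 * (u i2 0 * t 0 j))).
      by rewrite ler_wpM2l.
    by rewrite mulrCA ler_wpM2l.
  - by move=> i j ui; apply: le_trans (Wu i j) _; rewrite ui mul0r.
(* The lower end for [t 0 j]. It is attained at a row, so the first family, at the function choosing
   that row in each column, bounds the sum by one. *)
pose low j := W [arg max_(i > Ordinal n1_gt0) (W i j / u i 0)]%O j /
  u [arg max_(i > Ordinal n1_gt0) (W i j / u i 0)]%O 0.
have lowP i j : W i j / u i 0 <= low j.
  by rewrite /low; case: arg_maxP => //= i' _; apply.
have low_ge0 j : 0 <= low j by rewrite divr_ge0.
have sum_low : \sum_j low j <= 1.
  by have := Wa [ffun j => [arg max_(i > Ordinal n1_gt0) (W i j / u i 0)]%O];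
    under eq_bigr do rewrite ffunE.
have W_low i j : W i j <= u i 0 * low j.
  have [ui|nz] := eqVneq (u i 0) 0; first by rewrite ui mul0r Wu.
  by rewrite mulrC -ler_pdivrMr ?u_gt0.
(* The last clause is stated for every [s] below [upp j], so that it applies to points inside the
   segment from [low] to [upp]. *)
have [upp [upp_low sum_upp W_upp]] : exists upp : 'I_n2 -> R,
    [/\ forall j, low j <= upp j, 1 <= \sum_j upp j
      & forall i j s, s <= upp j -> l i 0 * s <= W i j].
  case: (pickP (fun i => 0 < l i 0)) => [i0 li0|nl]; last first.
    (* No row bounds [t] from above; raising each column by one suffices for the sum to reach one,
       as there is a column and [low] is nonnegative. *)
    exists (fun j => low j + 1); split=> //.
    - by move=> j; rewrite lerDl.
    - rewrite (bigD1 (Ordinal n2_gt0)) //=.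
      have : 0 <= \sum_(i < n2 | i != Ordinal n2_gt0) (low i + 1).
        by apply: sumr_ge0 => j _; have := low_ge0 j; lra.
      have := low_ge0 (Ordinal n2_gt0); lra.
    - move=> i j s _; suff -> : l i 0 = 0 by rewrite mul0r.
      by apply/le_anti; rewrite l0 leNgt nl.
  pose g j := [arg min_(i < i0 | 0 < l i 0) (W i j / l i 0)]%O.
  have gP j : 0 < l (g j) 0 /\ forall i, 0 < l i 0 -> W (g j) j / l (g j) 0 <= W i j / l i 0.
    by rewrite /g; case: arg_minP.
  exists (fun j => W (g j) j / l (g j) 0); split.
  - move=> j; have [lg _] := gP j.
    rewrite ler_pdivlMr // /low; set i := ([arg max_(_ > _) _])%O.
    have [->|nz] := eqVneq (u i 0) 0; first by rewrite invr0 mulr0 mul0r.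
    rewrite mulrAC ler_pdivrMr ?u_gt0 // mulrC [W (g j) j * _]mulrC.
    exact: Wc.
  - have := Wb [ffun j => g j]; under eq_bigr do rewrite ffunE.
    by apply=> j; rewrite ffunE; case: (gP j).
  - move=> i j s sg; have [li|li] := boolP (0 < l i 0).
      by rewrite mulrC -ler_pdivlMr // (le_trans sg) //; case: (gP j) => _; apply.
    have -> : l i 0 = 0 by apply/le_anti; rewrite l0 leNgt li.
    by rewrite mul0r.
(* The parameter at which the segment from [low] to [upp] crosses the hyperplane of sum one. If the
   two sums agree, both equal one. *)
have [lam [lam0 lam1 lamE]] : exists lam : R, [/\ 0 <= lam, lam <= 1 &
    \sum_j low j + lam * (\sum_j upp j - \sum_j low j) = 1].
  have [e|ne] := eqVneq (\sum_j upp j) (\sum_j low j).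
    by exists 0; split; rewrite ?ler01 //; lra.
  have gt : 0 < \sum_j upp j - \sum_j low j.
    rewrite subr_gt0 lt_def ne; exact: ler_sum.
  exists ((1 - \sum_j low j) / (\sum_j upp j - \sum_j low j)); split.
  - by rewrite divr_ge0 ?(ltW gt) // subr_ge0.
  - by rewrite ler_pdivrMr // mul1r; lra.
  - by rewrite divfK ?gt_eqF //; lra.
exists (\row_j (low j + lam * (upp j - low j))); split.
- under eq_bigr do rewrite mxE.
  by rewrite big_split /= -mulr_sumr sumrB.
- move=> i j; rewrite mxE; have := upp_low j => ul.
  apply/andP; split.
    by apply: W_upp; nra.
  apply: le_trans (W_low i j) _; rewrite ler_wpM2l // lerDl mulr_ge0 //; lra.
- move=> j; rewrite mxE; have := upp_low j; have := low_ge0 j; nra.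
Qed.

(** The five families are indexed by finite types, so they can be listed. Rows with [u i 0 = 0] are
    allowed here; [sd] and [se] together pin their entries to zero. *)
Lemma polyhedral_conv_Urow : (0 < n1)%N -> (0 < n2)%N ->
  polyhedral (conv (Urow l u : set 'M[R]_(n1, n2))).
Proof.
move=> n1_gt0 n2_gt0.
pose T : finType := {ffun 'I_n2 -> 'I_n1}.
pose V : finType := ('I_n1 * 'I_n2)%type.
pose T3 : finType := ('I_n2 * ('I_n1 * 'I_n1))%type.
pose term (a : R) (i : 'I_n1) (j : 'I_n2) : {ffun V -> R} := lterm a (i, j).
pose sa := [seq LinLe (\sum_j term (u (f j) 0)^-1 (f j) j) 1
  | f : {ffun 'I_n2 -> 'I_n1} <- enum T & predT f].
pose sb := [seq LinLe (- \sum_j term (l (f j) 0)^-1 (f j) j) (-1)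
  | f : {ffun 'I_n2 -> 'I_n1} <- enum T & [forall j, 0 < l (f j) 0]].
pose sc := [seq LinLe (term (l p.2.1 0) p.2.2 p.1 - term (u p.2.2 0) p.2.1 p.1) 0
  | p <- enum T3 & 0 < l p.2.1 0].
pose sd := [seq LinLe (- term 1 p.1 p.2) 0 | p <- enum V & predT p].
pose se := [seq LinLe (term 1 p.1 p.2) 0 | p <- enum V & u p.1 0 == 0].
exists (sa ++ sb ++ sc ++ sd ++ se) => W; rewrite conv_row_ineqs //.
pose x (v : 'I_n1 * 'I_n2) : R := W v.1 v.2; rewrite -/x.
have lterms (g : 'I_n2 -> R) (f : {ffun 'I_n2 -> 'I_n1}) :
    lform (\sum_j term (g j) (f j) j) x = \sum_j W (f j) j * g j.
  by rewrite lform_sum; apply: eq_bigr => j _; rewrite lform_lterm mulrC.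
rewrite !satisfies_cat; split=> [[ha hb hc hd he]|].
  repeat split.
  - by apply/satisfies_filter => f _; rewrite /= lterms.
  - by apply/satisfies_filter => f /forallP lf; rewrite /= lformN lterms lerN2 hb.
  - apply/satisfies_filter => p lp.
    by rewrite /= lformD lformN !lform_lterm subr_le0 hc.
  - by apply/satisfies_filter => p _; rewrite /= lformN lform_lterm mul1r oppr_le0 hd.
  - by apply/satisfies_filter => p /eqP up; rewrite /= lform_lterm mul1r he.
case=> /satisfies_filter ha [/satisfies_filter hb [/satisfies_filter hc
  [/satisfies_filter hd /satisfies_filter he]]]; split.
- by move=> f; have := ha f isT; rewrite /= lterms.
- move=> f lf; have := hb f; rewrite /= lformN lterms lerN2; apply.
  exact/forallP.
- move=> j i1 i2 li; have := hc (j, (i1, i2)) li.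
  by rewrite /= lformD lformN !lform_lterm subr_le0.
- by move=> i j; have := hd (i, j) isT; rewrite /= lformN lform_lterm mul1r oppr_le0.
- by move=> i j /eqP ui; have := he (i, j) ui; rewrite /= lform_lterm mul1r.
Qed.

End RowHull.

(** * Ordered partitions as fibres of maps *)

Section OrderedPartitions.
Variables (m n : nat).

(** Since parts may be empty, ordered partitions of the columns into [m] parts correspond exactly to
    maps from columns to ['I_m], that is, to choices of a row in each column. *)
Definition fibers (f : 'I_n -> 'I_m) : {ffun 'I_m -> {set 'I_n}} :=
  [ffun k => finset (fun j => f j == k)].

Lemma in_fibers f k j : (j \in fibers f k) = (f j == k).
Proof. by rewrite ffunE inE. Qed.

Lemma fibers_ordered_partition f : fibers f \in ordered_partitions m [set: 'I_n].
Proof.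
rewrite inE; apply/andP; split.
  apply/forallP => k; apply/forallP => k'; apply/implyP => kk'.
  apply/pred0P => j /=; rewrite !in_fibers.
  by apply/negbTE; apply: contraNN kk' => /andP[/eqP <- /eqP <-].
apply/eqP/setP => j; rewrite inE; apply/bigcupP; exists (f j) => //.
by rewrite in_fibers.
Qed.

Lemma ordered_partition_fibers T : T \in ordered_partitions m [set: 'I_n] ->
  exists f, T = fibers f.
Proof.
rewrite inE => /andP[/forallP dis /eqP cov].
have /fin_all_exists [f fT] : forall j, exists k, j \in T k.
  move=> j; have : j \in \bigcup_k T k by rewrite cov inE.
  by case/bigcupP => k _; exists k.
exists f; apply/ffunP => k; apply/setP => j; rewrite in_fibers.
apply/idP/eqP => [jk|<-] //.
apply/eqP; apply: contraTT jk => fjk.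
have /forallP/(_ k)/implyP/(_ fjk) := dis (f j).
by move/pred0P/(_ j); rewrite /= fT /= => ->.
Qed.

Lemma sum_fibers (V : nmodType) (f : 'I_n -> 'I_m) (F : 'I_m -> 'I_n -> V) :
  \sum_k \sum_(j in fibers f k) F k j = \sum_j F (f j) j.
Proof.
rewrite (exchange_big_dep predT) //=; apply: eq_bigr => j _.
by under eq_bigl do rewrite in_fibers eq_sym; rewrite big_pred1_eq.
Qed.

Lemma all_ordered_partitions (P : {ffun 'I_m -> {set 'I_n}} -> Prop) :
  (forall T, T \in ordered_partitions m [set: 'I_n] -> P T) <->
  forall f, P (fibers f).
Proof.
split=> [h f|h T /ordered_partition_fibers[f ->]] //.
exact/h/fibers_ordered_partition.
Qed.

End OrderedPartitions.

(** * The inequalities (a) to (d) and the explicit extended system *)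

Section RowInequalities.
Variables (R : realFieldType) (n1 n2 : nat).

Lemma ineq_a_fibers (u : 'cV[R]_n1) (W : 'M[R]_(n1, n2)) f :
  ineq_a u W (fibers f) = (\sum_j W (f j) j / u (f j) 0 <= 1).
Proof. by rewrite /ineq_a (sum_fibers f (fun i j => W i j / u i 0)). Qed.

Lemma ineq_b_fibers (l : 'cV[R]_n1) (W : 'M[R]_(n1, n2)) f :
  @ineq_b _ _ _ l W (fibers f) =
  (1 <= \sum_j W (enum_val (f j)) j / l (enum_val (f j)) 0).
Proof.
by rewrite /ineq_b
  (sum_fibers f (fun k j => W (enum_val k) j / l (enum_val k) 0)).
Qed.

(** Family (b) is indexed by the numbering of the positive rows; this transports a choice of
    positive rows to that numbering. *)
Lemma enum_rank_pos_rows (l : 'cV[R]_n1) (g : 'I_n2 -> 'I_n1) :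
  (forall j, 0 < l (g j) 0) ->
  exists f : 'I_n2 -> 'I_#|pos_rows l|, forall j, enum_val (f j) = g j.
Proof.
move=> lg; apply: (@fin_all_exists _ _ (fun j k => enum_val k = g j)).
move=> j; have gj : g j \in pos_rows l by rewrite inE.
by exists (enum_rank_in gj (g j)); rewrite enum_rankK_in.
Qed.

Lemma conv_row_partitions (l u : 'cV[R]_n1) (W : 'M[R]_(n1, n2)) :
  row_bounds l u -> (0 < n1)%N -> (0 < n2)%N -> (forall i, 0 < u i 0) ->
  conv (Urow l u) W <->
  [/\ forall T : {ffun 'I_n1 -> {set 'I_n2}},
        T \in ordered_partitions n1 [set: 'I_n2] -> ineq_a u W T,
      pos_rows l != finset.set0 ->
        forall T : {ffun 'I_#|pos_rows l| -> {set 'I_n2}},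
          T \in ordered_partitions #|pos_rows l| [set: 'I_n2] -> ineq_b W T,
      forall (j : 'I_n2) (i1 i2 : 'I_n1), i1 \in pos_rows l ->
        i1 != i2 -> l i1 0 * W i2 j <= u i2 0 * W i1 j
    & forall i j, 0 <= W i j].
Proof.
move=> lu n1_gt0 n2_gt0 u_gt0; rewrite conv_row_ineqs //.
split=> [[ha hb hc hd _]|[/all_ordered_partitions ha hb hc hd]].
  split=> //.
  - apply/all_ordered_partitions => f; rewrite ineq_a_fibers.
    by have := ha (finfun f); under eq_bigr do rewrite ffunE.
  - move=> _; apply/all_ordered_partitions => f; rewrite ineq_b_fibers.
    have := hb [ffun j => enum_val (f j)]; under eq_bigr do rewrite ffunE.
    by apply=> j; rewrite ffunE; have := enum_valP (f j); rewrite inE.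
  - by move=> j i1 i2 li _; apply: hc; rewrite inE in li.
split=> //.
- by move=> f; rewrite -ineq_a_fibers.
- move=> g lg; have [f fg] := enum_rank_pos_rows lg.
  (* There is a column, so a choice of positive rows has a value. *)
  have I0 : pos_rows l != finset.set0.
    by apply/set0Pn; exists (g (Ordinal n2_gt0)); rewrite inE.
  have /all_ordered_partitions/(_ f) := hb I0.
  by rewrite ineq_b_fibers; under eq_bigr do rewrite fg.
(* The diagonal case, absent from (c), follows from [l <= u] and [0 <= W]. *)
- move=> j i1 i2 li; have [<-|ne] := eqVneq i1 i2; last by apply: hc; rewrite ?inE.
  by rewrite ler_wpM2r //; case/andP: (lu i1).
- by move=> i j ui; have := u_gt0 i; rewrite ui ltxx.
Qed.

Lemma row_ext_systemP (l u : 'cV[R]_n1) (t : 'rV[R]_n2) (W : 'M[R]_(n1, n2)) :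
  satisfies (row_ext_system n2 l u) (ext_point t W) <-> row_ext l u t W.
Proof.
rewrite /satisfies /row_ext_system /= !all_cat all_map lform_sum.
under eq_bigr do rewrite lform_lterm mul1r.
split.
  case/and4P => /eqP ht /all_allpairsP hl /all_allpairsP hu /allP h0; split=> //.
    move=> i j; have /= := hl i j (mem_enum _ _) (mem_enum _ _).
    have /= := hu i j (mem_enum _ _) (mem_enum _ _).
    rewrite !lformD !lformN !lform_lterm /= !mul1r !subr_le0 => -> -> //.
  move=> j; have /= := h0 j (mem_enum _ _).
  by rewrite lformN lform_lterm mul1r oppr_le0.
case=> ht hW h0; apply/and4P; split.
- exact/eqP.
- apply/all_allpairsP => i j _ _ /=; rewrite !lformD !lformN !lform_lterm /= !mul1r.
  by rewrite subr_le0; case/andP: (hW i j).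
- apply/all_allpairsP => i j _ _ /=; rewrite !lformD !lformN !lform_lterm /= !mul1r.
  by rewrite subr_le0; case/andP: (hW i j).
- by apply/allP => j _ /=; rewrite lformN lform_lterm mul1r oppr_le0 h0.
Qed.

End RowInequalities.

Lemma row_ext_system_size (R : realFieldType) :
  exists p : {poly {poly nat}}, forall (n1 n2 : nat) (l u : 'cV[R]_n1),
    (system_size (row_ext_system n2 l u) <= p.[n1%:P].[n2])%N.
Proof.
(* The outer variable stands for [n1], the inner one for [n2]. The first factor counts constraints,
   the second the variables and the right-hand side. *)
exists ((1 + 'X%:P * 'X + 'X%:P * 'X + 'X%:P) * (1 + 'X%:P + 'X%:P * 'X)).
move=> n1 n2 l u; rewrite !(hornerM, hornerD, hornerX, hornerC).
rewrite /system_size /= !size_cat !size_allpairs size_map !size_enum_ord.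
rewrite card_sum card_prod !card_ord.
by apply: (@leq_mul _ _ (1 + n2 * n1 + n2 * n1 + n2) (1 + n2 + n2 * n1)); nia.
Qed.

(** * Cost of programs *)

(** Literals weigh their bits and each operation adds one, so that [2 ^ (L * esize e)] bounds the
    value of [e] when all cells are at most [2 ^ L]. *)
Fixpoint esize (e : expr) : nat :=
  match e with
  | ELit z => bitsize z
  | EGet _ e1 => (esize e1).+1
  | EAdd e1 e2 | ESub e1 e2 | EMul e1 e2 => (esize e1 + esize e2).+1
  end.

Fixpoint csize (c : cmd) : nat :=
  match c with
  | CSkip => 1
  | CSet _ e1 e2 => (esize e1 + esize e2).+1
  | CEmit e => (esize e).+1
  | CSeq c1 c2 => (csize c1 + csize c2).+1
  | CIf e c1 c2 => (esize e + csize c1 + csize c2).+1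
  | CWhile e c1 => (esize e + csize c1).+1
  end.

Definition bounded (L : nat) (s : store) : Prop :=
  forall a i, (`|s a i| <= 2 ^ L)%N.

Lemma bounded_update L s a i z :
  bounded L s -> (`|z| <= 2 ^ L)%N -> bounded L (update s a i z).
Proof. by move=> sL zL b j; rewrite /update; case: ifP. Qed.

Lemma absz_lt_bitsize z : (`|z| < 2 ^ bitsize z)%N.
Proof.
apply: (leq_trans (trunc_log_ltn _ (isT : 1 < 2)%N)).
by rewrite leq_exp2l // /bitsize.
Qed.

Lemma bitsize_le z k : (`|z| <= 2 ^ k)%N -> (bitsize z <= k.+2)%N.
Proof.
move=> zk; rewrite /bitsize !ltnS -(trunc_expnK k (isT : 1 < 2)%N).
exact: leq_trunc_log.
Qed.

(** A product adds exponents. A sum at most doubles the larger operand, which the extra unit of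
    [esize] absorbs because [L] is positive. *)
Lemma eval_bound L s e : (0 < L)%N -> bounded L s ->
  (`|eval s e| <= 2 ^ (L * esize e))%N.
Proof.
move=> L0 sL.
have mono a b : (a <= b)%N -> (2 ^ (L * a) <= 2 ^ (L * b))%N.
  by move=> ab; rewrite leq_exp2l // leq_mul2l ab orbT.
have double a b : (2 ^ (L * a) + 2 ^ (L * b) <= 2 ^ (L * (a + b).+1))%N.
  rewrite mulnS expnD.
  have h2 : (2 <= 2 ^ L)%N by rewrite -{1}(expn1 2) leq_exp2l.
  have ha := mono _ _ (leq_addr b a); have hb := mono _ _ (leq_addl a b).
  by nia.
elim: e => [z|a e IH|e1 IH1 e2 IH2|e1 IH1 e2 IH2|e1 IH1 e2 IH2] /=.
- apply: leq_trans (ltnW (absz_lt_bitsize z)) _.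
  by rewrite leq_exp2l // leq_pmull.
- by apply: leq_trans (sL _ _) _; rewrite leq_exp2l // mulnS leq_addr.
- by apply: leq_trans (double _ _); lia.
- by apply: leq_trans (double _ _); lia.
- rewrite abszM; apply: leq_trans (leq_mul IH1 IH2) _.
  by rewrite -expnD -mulnDr mono.
Qed.

(** There are at most [esize e] nodes, each with a value of at most [L * esize e + 2] bits. *)
Lemma ecost_bound L s e : (0 < L)%N -> bounded L s ->
  (ecost s e <= esize e ^ 2 * L.+2)%N.
Proof.
move=> L0 sL.
have bits e' : (bitsize (eval s e') <= L * esize e' + 2)%N.
  by rewrite addn2; apply: bitsize_le; apply: eval_bound.
elim: e => [z|a e IH|e1 IH1 e2 IH2|e1 IH1 e2 IH2|e1 IH1 e2 IH2] /=.
- by rewrite addn0 -mulnn; have := isT : (1 < bitsize z)%N; nia.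
- by have /= := bits (EGet a e); nia.
- by have /= := bits (EAdd e1 e2); nia.
- by have /= := bits (ESub e1 e2); nia.
- by have /= := bits (EMul e1 e2); nia.
Qed.

(* Counts [k] elementary steps of a run whose cells stay below [2 ^ L]; the
   factor turns steps into logarithmic cost, uniformly in the expressions
   occurring in [c]. *)
Definition wp (L : nat) (c : cmd) (s : store) (k : nat)
    (Q : store -> seq int -> Prop) : Prop :=
  exists s' o t, [/\ exec c s s' o t, (t <= k * (csize c ^ 2 * L.+3))%N & Q s' o].

Lemma wp_weaken L c s k k' (Q Q' : store -> seq int -> Prop) :
  wp L c s k Q -> (k <= k')%N -> (forall s' o, Q s' o -> Q' s' o) ->
  wp L c s k' Q'.
Proof.
move=> [s' [o [t [ex tk Qs]]]] kk QQ; exists s', o, t; split=> //; last exact: QQ.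
by apply: leq_trans tk _; rewrite leq_mul2r kk orbT.
Qed.

(** * Proof rules with step budgets *)

Section Rules.
Variable L : nat.
Lemma wp_seq c1 c2 s k1 k2 (Q : store -> seq int -> Prop) :
  wp L c1 s k1 (fun s' o => wp L c2 s' k2 (fun s'' o' => Q s'' (o ++ o'))) ->
  wp L (CSeq c1 c2) s (k1 + k2) Q.
Proof.
move=> [s1 [o1 [t1 [ex1 tk1 [s2 [o2 [t2 [ex2 tk2 Qs]]]]]]]].
do 3!eexists; split; [exact: ExSeq ex1 ex2| |exact: Qs].
by rewrite mulnDl /=; apply: leq_add; apply: leq_trans; [exact: tk1| |exact: tk2|];
  rewrite leq_mul2l leq_mul2r leq_exp2r //; apply/orP; right; apply/orP; right;
  lia.
Qed.

Hypothesis L_gt0 : (0 < L)%N.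

Lemma ecost_lt s e n : bounded L s -> (esize e < n)%N -> (ecost s e < n ^ 2 * L.+3)%N.
Proof.
move=> sL en; apply: leq_ltn_trans (ecost_bound e L_gt0 sL) _.
by rewrite ltn_mul // ltn_exp2r.
Qed.

Lemma wp_set s a e1 e2 (Q : store -> seq int -> Prop) : bounded L s ->
  Q (update s a `|eval s e1|%N (eval s e2)) [::] -> wp L (CSet a e1 e2) s 1 Q.
Proof.
move=> sL Qs; do 3!eexists; split; [exact: ExSet| |exact: Qs].
have := ecost_bound e1 L_gt0 sL; have := ecost_bound e2 L_gt0 sL.
by rewrite mul1n /= -!mulnn; nia.
Qed.

Lemma wp_emit s e (Q : store -> seq int -> Prop) : bounded L s ->
  Q s [:: eval s e] -> wp L (CEmit e) s 1 Q.
Proof.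
move=> sL Qs; do 3!eexists; split; [exact: ExEmit| |exact: Qs].
by rewrite mul1n; apply: ecost_lt => /=.
Qed.

Lemma wp_if e c1 c2 s k (Q : store -> seq int -> Prop) : bounded L s ->
  (0 < eval s e -> wp L c1 s k Q) -> (eval s e <= 0 -> wp L c2 s k Q) ->
  wp L (CIf e c1 c2) s k.+1 Q.
Proof.
move=> sL h1 h2.
have ce : (ecost s e < csize (CIf e c1 c2) ^ 2 * L.+3)%N.
  by apply: ecost_lt => //=; lia.
have mono m n : (m <= n)%N -> (k * (m ^ 2 * L.+3) <= k * (n ^ 2 * L.+3))%N.
  by move=> mn; rewrite leq_mul2l leq_mul2r leq_exp2r // mn !orbT.
have [e0|e0] := ltrP 0 (eval s e).
  have [s' [o [t [ex tk Qs]]]] := h1 e0.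
  do 3!eexists; split; [exact: ExIfTrue e0 ex| |exact: Qs].
  rewrite mulSn -addSn leq_add //; apply: leq_trans tk (mono _ _ _).
  by rewrite /=; lia.
have [s' [o [t [ex tk Qs]]]] := h2 e0.
do 3!eexists; split; [exact: ExIfFalse e0 ex| |exact: Qs].
rewrite mulSn -addSn leq_add //; apply: leq_trans tk (mono _ _ _).
by rewrite /=; lia.
Qed.

(** The invariant carries the round number and the whole output so far; the guard holds exactly in
    rounds below [n], which gives termination. Each round pays one unit for its test, and the final
    failing test one more. *)
Lemma wp_while e c s k n (I : nat -> store -> seq int -> Prop) :
  (forall i s o, I i s o -> bounded L s /\ (0 < eval s e) = (i < n)%N) ->
  (forall i s o, (i < n)%N -> I i s o ->
     wp L c s k (fun s' o' => I i.+1 s' (o ++ o'))) ->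
  I 0 s [::] -> wp L (CWhile e c) s (n * k.+1).+1 (I n).
Proof.
move=> Ie Ic I0.
set C := (csize (CWhile e c) ^ 2 * L.+3)%N.
have mono j : (j * (csize c ^ 2 * L.+3) <= j * C)%N.
  rewrite leq_mul2l leq_mul2r leq_exp2r //; apply/orP; right; apply/orP; right.
  by rewrite /=; lia.
(* Induction on the number [m] of remaining rounds. *)
suff loop m : forall i s o, (i + m = n)%N -> I i s o ->
    exists s' o' t, [/\ exec (CWhile e c) s s' o' t, (t <= (m * k.+1).+1 * C)%N
      & I n s' (o ++ o')].
  by apply: loop I0.
elim: m => [|m IH] i s1 o1 im Is; have [sL cond] := Ie _ _ _ Is.
  rewrite addn0 in im; rewrite -im; exists s1, [::], (ecost s1 e).+1.
  split; last by rewrite cats0.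
    by apply: ExWhileFalse; rewrite leNgt cond im ltnn.
  by rewrite mul0n mul1n; apply: ecost_lt => //=; lia.
have i_lt : (i < n)%N by lia.
have [s2 [o2 [t2 [ex2 tk2 I2]]]] := Ic _ _ _ i_lt Is.
have [s3 [o3 [t3 [ex3 tk3 I3]]]] := IH i.+1 s2 (o1 ++ o2) (etrans (addSnnS _ _) im) I2.
exists s3, (o2 ++ o3), ((ecost s1 e + t2 + t3).+1)%N; split; last by rewrite catA.
  by apply: ExWhileTrue ex2 ex3; rewrite cond.
have ce : (ecost s1 e < C)%N by apply: ecost_lt => //=; lia.
by have := leq_trans tk2 (mono k); nia.
Qed.

Definition CFor (v : nat) (e : expr) (c : cmd) : cmd :=
  CSeq (CSet v (ELit 0) (ELit 0))
    (CWhile (ESub e (EGet v (ELit 0)))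
       (CSeq c (CSet v (ELit 0) (EAdd (EGet v (ELit 0)) (ELit 1))))).

(** The bound [e] is evaluated anew at each test, so the invariant must fix its value. The two units
    per round are the test and the increment; the final two are the initialization and the failing
    test. *)
Lemma wp_for v e c s k (n : nat) (I : nat -> store -> seq int -> Prop) :
  bounded L s ->
  (forall i s o, I i s o -> [/\ bounded L s, eval s e = n & s v 0%N = i]) ->
  I 0 (update s v 0 0) [::] ->
  (forall i s o, (i < n)%N -> I i s o ->
     wp L c s k (fun s' o' =>
       bounded L s' /\ I i.+1 (update s' v 0 (s' v 0%N + 1)) (o ++ o'))) ->
  wp L (CFor v e c) s (n * k.+2 + 2)%N (I n).
Proof.
move=> sL Ie I0 Ic; rewrite addn2 -add1n; apply: wp_seq; apply: wp_set => //=.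
apply: wp_while => //.
  move=> i s' o /Ie[s'L /= -> ->]; split=> //.
  by rewrite subr_gt0 ltz_nat.
move=> i s' o i_lt Is; rewrite -addn1; apply: wp_seq.
apply: wp_weaken (Ic _ _ _ i_lt Is) _ _ => // s2 o2 [s2L I2].
by apply: wp_set; rewrite //= cats0.
Qed.

End Rules.

(** At most [B * S ^ 2] steps, each of cost at most a constant times [A * S ^ 2 + 3], where 3 is
    absorbed in [3 * S ^ 2] for positive [S]. *)
Lemma polytime_of_wp (X : Type) (valid : X -> Prop) (enc : X -> seq int)
    (sol : X -> seq int -> Prop) (c : cmd) (A B : nat) :
  (forall x, valid x -> let S := input_size (enc x) in
     wp (A * S ^ 2)%N c (init_store (enc x)) (B * S ^ 2)%N (fun _ o => sol x o)) ->
  polytime_solvable valid enc sol.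
Proof.
move=> h; exists c, ((B * csize c ^ 2 * (A + 3))%N%:P * 'X^4).
move=> x /h /= [s [o [t [ex tk so]]]]; exists s, o, t; split=> //.
apply: leq_trans tk _; rewrite hornerM hornerC hornerXn.
set S := input_size _.
rewrite -[leqRHS]/(B * csize c ^ 2 * (A + 3) * (S * (S * (S * S))))%N.
case: S => [|S]; first by rewrite !muln0.
apply: (@leq_trans (B * S.+1 ^ 2 * (csize c ^ 2 * ((A + 3) * S.+1 ^ 2)))); last first.
  by apply: eq_leq; rewrite -!mulnn; ring.
rewrite !leq_mul2l mulnDl -addn3 leq_add2l leq_pmulr ?expn_gt0 //.
by rewrite !orbT.
Qed.

(** * Optimization and separation programs *)

Section Fractions.

Definition frac (k : nat) (q : rat) (N D : int) : Prop :=
  [/\ 0 < D, q = N%:~R / D%:~R, (`|N| <= 2 ^ k)%N & (`|D| <= 2 ^ k)%N].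

Lemma frac_weaken k k' q N D : (k <= k')%N -> frac k q N D -> frac k' q N D.
Proof.
by move=> kk [D0 qE Nk Dk]; split=> //; [apply: leq_trans Nk _|apply: leq_trans Dk _];
  rewrite leq_exp2l.
Qed.

Lemma frac_mul k m q r N D a b : frac k q N D -> frac m r a b ->
  frac (k + m) (q * r) (N * a) (D * b).
Proof.
move=> [D0 -> Nk Dk] [b0 -> am bm]; split.
- exact: mulr_gt0.
- by rewrite !intrM mulf_div.
- by rewrite abszM expnD leq_mul.
- by rewrite abszM expnD leq_mul.
Qed.

(** Stated for arbitrary integers because it also bounds the accumulator of the separation program
    once its denominator is zero. *)
Lemma absz_mulD_le k m N D a b :
  (`|N| <= 2 ^ k)%N -> (`|D| <= 2 ^ k)%N -> (`|a| <= 2 ^ m)%N -> (`|b| <= 2 ^ m)%N ->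
  (`|(N * b + a * D)%R| <= 2 ^ (m.+1 + k))%N.
Proof.
move=> Nk Dk am bm.
have : (`|(N * b + a * D)%R| <= `|N| * `|b| + `|a| * `|D|)%N by rewrite -!abszM; lia.
move=> /leq_trans -> //; rewrite addSn expnS mul2n -addnn expnD.
by apply: leq_add; [rewrite mulnC|]; apply: leq_mul.
Qed.

(** The length grows by [m.+1], a quantity attached to the summand alone, so repeated addition costs
    linearly many bits. *)
Lemma frac_add k m q r N D a b : frac k q N D -> frac m r a b ->
  frac (m.+1 + k) (q + r) (N * b + a * D) (D * b).
Proof.
move=> [D0 -> Nk Dk] [b0 -> am bm]; split.
- exact: mulr_gt0.
- by rewrite intrD !intrM addf_div ?intr_eq0 ?gt_eqF.
- exact: absz_mulD_le.
- rewrite abszM addSn expnS expnD mulnC (leq_trans (leq_mul bm Dk)) //.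
  by rewrite leq_pmull.
Qed.

Lemma frac_sign k q N D (sg : int) : `|sg|%N = 1%N -> frac k q N D ->
  frac k (sg%:~R * q) (sg * N) D.
Proof.
by move=> sg1 [D0 -> Nk Dk]; split; rewrite ?abszM ?sg1 ?mul1n // intrM mulrA.
Qed.

Lemma frac_inv k q N D : 0 < N -> frac k q N D -> frac k q^-1 D N.
Proof. by move=> N0 [D0 -> Nk Dk]; split=> //; rewrite invf_div. Qed.

Lemma frac_lt k m q r N D a b : frac k q N D -> frac m r a b ->
  (q < r) = (0 < a * D - N * b).
Proof.
move=> [D0 -> _ _] [b0 -> _ _].
by rewrite ltr_pdivrMr ?ltr0z // mulrAC ltr_pdivlMr ?ltr0z // -!intrM ltr_int subr_gt0.
Qed.

Lemma frac_gt0 k q N D : frac k q N D -> (0 < q) = (0 < N).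
Proof. by move=> [D0 -> _ _]; rewrite pmulr_lgt0 ?invr_gt0 ?ltr0z. Qed.

(* The fraction [-1 / 0] stands for the maximum of the empty family. *)
Definition best (P : pred nat) (f : nat -> rat) (n : nat) (N D z : int) : Prop :=
  [/\ N = -1, D = 0 & forall k, (k < n)%N -> ~~ P k] \/
  exists2 b, z = Posz b & [/\ (b < n)%N, P b, 0 < D, f b = N%:~R / D%:~R
    & forall k, (k < n)%N -> P k -> f k <= f b].

Variables (P : pred nat) (f : nat -> rat) (n : nat).

Lemma best_skip N D z : ~~ P n -> best P f n N D z -> best P f n.+1 N D z.
Proof.
move=> nP [[N1 D0 none]|[b zb [bn Pb D0 fb fmax]]]; [left|right; exists b => //]; split=> //.
- by move=> k; rewrite ltnS leq_eqVlt => /predU1P[->|/none].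
- exact: ltnW.
- by move=> k; rewrite ltnS leq_eqVlt => /predU1P[->|kn]; [rewrite (negPf nP)|exact: fmax].
Qed.

Lemma best_update k N D z N' D' : P n -> frac k (f n) N' D' ->
  best P f n N D z -> 0 < N' * D - N * D' -> best P f n.+1 N' D' n.
Proof.
move=> Pn [D'0 fn Nk Dk] bst gt; right; exists n => //; split=> //.
move=> i; rewrite ltnS leq_eqVlt => /predU1P[->//|i_n] Pi.
case: bst => [[_ _ none]|[b _ [bn Pb D0 fb fmax]]]; first by rewrite (negPf (none _ i_n)) in Pi.
apply: le_trans (fmax _ i_n Pi) (ltW _).
by rewrite fb fn ltr_pdivrMr ?ltr0z // mulrAC ltr_pdivlMr ?ltr0z // -!intrM ltr_int -subr_gt0.
Qed.

(** Against the initial pair -1 and 0 the tested value is [D'], which is positive: the first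
    candidate is never rejected. *)
Lemma best_keep k N D z N' D' : frac k (f n) N' D' ->
  best P f n N D z -> N' * D - N * D' <= 0 -> best P f n.+1 N D z.
Proof.
move=> [D'0 fn Nk Dk] bst le; case: bst => [[N1 D0 none]|[b zb [bn Pb D0 fb fmax]]].
  by move: le; rewrite N1 D0 mulr0 sub0r mulN1r opprK leNgt D'0.
right; exists b => //; split=> //; first exact: ltnW.
move=> i; rewrite ltnS leq_eqVlt => /predU1P[->|i_n] Pi; last exact: fmax.
by rewrite fb fn ler_pdivrMr ?ltr0z // mulrAC ler_pdivlMr ?ltr0z // -!intrM ler_int -subr_le0.
Qed.

End Fractions.

(** * The programs *)

Definition var (a : nat) : expr := EGet a (ELit 0).
Definition assign (a : nat) (e : expr) : cmd := CSet a (ELit 0) e.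

Definition nrow_expr : expr := EGet 0 (ELit 0).
Definition ncol_expr : expr := EGet 0 (ELit 1).
(** Addresses in the input array: two cells for the dimensions, then two cells per rational, for the
    lower bounds, the upper bounds and the matrix by rows. *)
Definition lo_expr : expr := EAdd (ELit 2) (EMul (ELit 2) (var 1)).
Definition up_expr : expr := EAdd lo_expr (EMul (ELit 2) nrow_expr).
Definition mat_expr : expr :=
  EAdd (EAdd (ELit 2) (EMul (ELit 4) nrow_expr))
    (EMul (ELit 2) (EAdd (EMul (var 1) ncol_expr) (var 2))).
Definition num (e : expr) : expr := EGet 0 e.
Definition den (e : expr) : expr := EGet 0 (EAdd e (ELit 1)).

Section Programs.
Variable sg : int.

(* Variables: 1 and 2 hold the row and column indices, 3/4 the current sum,
   5/6 the best value so far and 7 its index. *)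
Definition gain_expr : expr := EMul (ELit sg) (num mat_expr).

(** The numerator is updated before the denominator because it uses the old denominator. *)
Definition accum (v : expr) : cmd :=
  CSeq (assign 3 (EAdd (EMul (var 3) (EMul (den mat_expr) (den v)))
                       (EMul (EMul gain_expr (num v)) (var 4))))
       (assign 4 (EMul (var 4) (EMul (den mat_expr) (den v)))).

Definition opt_search : cmd :=
  CFor 2 ncol_expr
    (CSeq (assign 3 (ELit 0))
    (CSeq (assign 4 (ELit 1))
    (CSeq (CFor 1 nrow_expr (CIf gain_expr (accum up_expr) (accum lo_expr)))
          (CIf (ESub (EMul (var 3) (var 6)) (EMul (var 5) (var 4)))
             (CSeq (assign 5 (var 3)) (CSeq (assign 6 (var 4)) (assign 7 (var 2))))
             CSkip)))).

(** Tests can only ask for positivity; for integers, one minus the square of the difference is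
    positive exactly in case of equality. *)
Definition equal_expr (e1 e2 : expr) : expr :=
  ESub (ELit 1) (EMul (ESub e1 e2) (ESub e1 e2)).

(** Nonzero output entries are copied from the input, where rationals are already reduced, so the
    output has the required encoding without any gcd. *)
Definition emit_rat (v : expr) : cmd := CSeq (CEmit (num v)) (CEmit (den v)).

Definition opt_output : cmd :=
  CFor 1 nrow_expr (CFor 2 ncol_expr
    (CIf (equal_expr (var 2) (var 7))
       (CIf gain_expr (emit_rat up_expr) (emit_rat lo_expr))
       (CSeq (CEmit (ELit 0)) (CEmit (ELit 1))))).

Definition opt_prog : cmd :=
  CSeq (assign 5 (ELit (-1))) (CSeq opt_search opt_output).

Definition ratio_num (v : expr) : expr := EMul gain_expr (den v).
Definition ratio_den (v : expr) : expr := EMul (den mat_expr) (num v).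

(* Cell [j] of array 7 holds the best row of column [j]. *)
Definition sep_column (v : expr) : cmd :=
  CFor 1 nrow_expr
    (CIf (num v)
       (CIf (ESub (EMul (ratio_num v) (var 6)) (EMul (var 5) (ratio_den v)))
          (CSeq (CSet 7 (var 2) (var 1))
          (CSeq (assign 5 (ratio_num v)) (assign 6 (ratio_den v))))
          CSkip)
       CSkip).

(** In a column without an eligible row the best pair keeps denominator 0. The product of
    denominators in variable 4 then becomes 0 for good and serves as a flag for an empty family. *)
Definition sep_search (v : expr) : cmd :=
  CSeq (assign 4 (ELit 1))
    (CFor 2 ncol_expr
       (CSeq (assign 5 (ELit (-1)))
       (CSeq (assign 6 (ELit 0))
       (CSeq (sep_column v)
       (CSeq (assign 3 (EAdd (EMul (var 3) (var 6)) (EMul (var 5) (var 4))))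
             (assign 4 (EMul (var 4) (var 6)))))))).

(** Rows of nonpositive weight print nothing, not a row of zeros: the incidence matrix for (b) has
    rows for the positive rows only. *)
Definition sep_output (v : expr) : cmd :=
  CFor 1 nrow_expr
    (CIf (num v)
       (CFor 2 ncol_expr
          (CIf (equal_expr (EGet 7 (var 2)) (var 1))
             (CEmit (ELit 1)) (CEmit (ELit 0))))
       CSkip).

(** The threshold is [sg] itself: the sum of the signed ratios is compared with 1 for (a) and with
    -1 for (b). *)
Definition sep_prog (v : expr) : cmd :=
  CSeq (sep_search v)
    (CIf (var 4)
       (CIf (ESub (var 3) (EMul (ELit sg) (var 4)))
          (CSeq (CEmit (ELit 1)) (sep_output v))
          (CEmit (ELit 0)))
       (CEmit (ELit 0))).

Hypothesis sg1 : `|sg|%N = 1%N.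

Variables (x : seq int) (n1 n2 S : nat).

Definition lo_at (i : nat) : nat := (2 + 2 * i)%N.
Definition up_at (i : nat) : nat := (lo_at i + 2 * n1)%N.
Definition mat_at (i j : nat) : nat := (2 + 4 * n1 + 2 * (i * n2 + j))%N.
Definition rat_at (k : nat) : rat := (nth 0 x k)%:~R / (nth 0 x k.+1)%:~R.

Hypothesis x_nrow : nth 0 x 0 = n1.
Hypothesis x_ncol : nth 0 x 1 = n2.
Hypothesis xS : forall k, (`|nth 0%R x k| <= 2 ^ S)%N.
Hypothesis lo_den : forall i, (i < n1)%N -> 0 < nth 0 x (lo_at i).+1.
Hypothesis up_den : forall i, (i < n1)%N -> 0 < nth 0 x (up_at i).+1.
Hypothesis mat_den : forall i j, (i < n1)%N -> (j < n2)%N -> 0 < nth 0 x (mat_at i j).+1.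
Hypothesis n1S : (n1 <= S)%N.
Hypothesis n2S : (n2 <= S)%N.
Hypothesis n1_gt0 : (0 < n1)%N.
Hypothesis n2_gt0 : (0 < n2)%N.

(* Bounds the [(2 * S + 1) * S] bits of a sum of at most [S] fractions with
   numerators and denominators of [2 * S] bits. *)
Let L := (3 * S ^ 2)%N.

Lemma acc_le_L k : (k <= S)%N -> ((S + S).+1 * k <= L)%N.
Proof. by rewrite /L -mulnn; nia. Qed.

Lemma S_le_L : (S <= L)%N.
Proof. by rewrite /L -mulnn; nia. Qed.

Lemma SS_le_L : (S + S <= L)%N.
Proof. by rewrite /L -mulnn; nia. Qed.

Lemma L_gt0 : (0 < L)%N.
Proof. by rewrite /L -mulnn; nia. Qed.

Lemma le_pow_L k m : (k <= 2 ^ m)%N -> (m <= L)%N -> (k <= 2 ^ L)%N.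
Proof. by move=> km mL; apply: leq_trans km _; rewrite leq_exp2l. Qed.

Lemma index_le_L k : (k <= S)%N -> (`|Posz k| <= 2 ^ L)%N.
Proof.
move=> kS; apply: leq_trans (ltnW (ltn_expl L (isT : 1 < 2)%N)).
exact: leq_trans kS S_le_L.
Qed.

Definition loaded (s : store) : Prop :=
  bounded L s /\ forall k, s 0%N k = nth 0 x k.

Lemma loaded_update s a i z : loaded s -> (0 < a)%N -> (`|z| <= 2 ^ L)%N ->
  loaded (update s a i z).
Proof.
move=> [sL sx] a0 zL; split; first exact: bounded_update.
by move=> k; rewrite /update ltn_eqF //= sx.
Qed.

Lemma eval_nrow s : loaded s -> eval s nrow_expr = n1.
Proof. by case=> _ sx; rewrite /= sx. Qed.

Lemma eval_ncol s : loaded s -> eval s ncol_expr = n2.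
Proof. by case=> _ sx; rewrite /= sx. Qed.

Lemma eval_lo (s : store) (i : nat) : s 1%N 0%N = i -> eval s lo_expr = lo_at i.
Proof. by move=> /= ->. Qed.

Lemma eval_up s (i : nat) : loaded s -> s 1%N 0%N = i -> eval s up_expr = up_at i.
Proof. by case=> _ sx; rewrite /= sx x_nrow => ->. Qed.

Lemma eval_mat s (i j : nat) : loaded s -> s 1%N 0%N = i -> s 2%N 0%N = j ->
  eval s mat_expr = mat_at i j.
Proof. by case=> _ sx; rewrite /= !sx x_nrow x_ncol => -> ->. Qed.

Lemma eval_num s e (k : nat) : loaded s -> eval s e = k -> eval s (num e) = nth 0 x k.
Proof. by case=> _ sx /= ->; rewrite sx. Qed.

Lemma eval_den s e (k : nat) : loaded s -> eval s e = k -> eval s (den e) = nth 0 x k.+1.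
Proof. by case=> _ sx /= ->; rewrite sx -addn1. Qed.

Lemma eval_equal (s : store) e1 e2 (a b : nat) : eval s e1 = a -> eval s e2 = b ->
  (0 < eval s (equal_expr e1 e2)) = (a == b).
Proof.
move=> /= -> ->; case: (eqVneq a b) => [->|ab]; first by rewrite subrr mulr0.
by apply/negbTE; rewrite -leNgt; nia.
Qed.

Lemma frac_at k : 0 < nth 0 x k.+1 -> frac S (rat_at k) (nth 0 x k) (nth 0 x k.+1).
Proof. by split. Qed.

Lemma wp_assign s a e (Q : store -> seq int -> Prop) : loaded s ->
  Q (update s a 0 (eval s e)) [::] -> wp L (assign a e) s 1 Q.
Proof. by case=> sL _ Qs; apply: wp_set => //; exact: L_gt0. Qed.


Lemma wp_skip s k (Q : store -> seq int -> Prop) : Q s [::] -> wp L CSkip s k.+1 Q.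
Proof.
move=> Qs; exists s, [::], 1%N; split=> //; exact: ExSkip.
Qed.

Definition gain (i j : nat) : rat := sg%:~R * rat_at (mat_at i j).

Lemma eval_gain s (i j : nat) : loaded s -> s 1%N 0%N = i -> s 2%N 0%N = j ->
  eval s gain_expr = sg * nth 0 x (mat_at i j).
Proof. by move=> sm si sj; rewrite -(eval_num sm (eval_mat sm si sj)). Qed.

Lemma frac_gain i j : (i < n1)%N -> (j < n2)%N ->
  frac S (gain i j) (sg * nth 0 x (mat_at i j)) (nth 0 x (mat_at i j).+1).
Proof. by move=> i_lt j_lt; apply/frac_sign/frac_at/mat_den. Qed.

(** [v] is evaluated again after variable 3 has changed, so its address is assumed in every loaded
    store with the same row index. *)
Lemma wp_accum v (k B : nat) s (i j : nat) q (Q : store -> seq int -> Prop) :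
  loaded s -> s 1%N 0%N = i -> s 2%N 0%N = j -> (i < n1)%N -> (j < n2)%N ->
  (forall s', loaded s' -> s' 1%N 0%N = i -> eval s' v = k) ->
  0 < nth 0 x k.+1 -> frac B q (s 3%N 0%N) (s 4%N 0%N) ->
  ((S + S).+1 + B <= L)%N ->
  (forall s', loaded s' -> (forall a, a != 3%N -> a != 4%N -> s' a 0%N = s a 0%N) ->
     frac ((S + S).+1 + B) (q + gain i j * rat_at k) (s' 3%N 0%N) (s' 4%N 0%N) ->
     Q s' [::]) ->
  wp L (accum v) s 2 Q.
Proof.
move=> sm si sj i_lt j_lt vk k_den sq BL Qs.
have fr := frac_add sq (frac_mul (frac_gain i_lt j_lt) (frac_at k_den)).
have [_ _ NL DL] := frac_weaken BL fr.
set N := (X in frac _ _ X _) in fr NL; set D := (X in frac _ _ _ X) in fr DL.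
have denE s' : loaded s' -> s' 1%N 0%N = i -> s' 2%N 0%N = j ->
    eval s' (EMul (den mat_expr) (den v)) =
    nth 0 x (mat_at i j).+1 * nth 0 x k.+1.
  move=> s'm s'i s'j.
  by rewrite -(eval_den s'm (eval_mat s'm s'i s'j)) -(eval_den s'm (vk _ s'm s'i)).
rewrite -[2%N]/(1 + 1)%N; apply: wp_seq; apply: wp_assign => //.
have -> : eval s (EAdd (EMul (var 3) (EMul (den mat_expr) (den v)))
    (EMul (EMul gain_expr (num v)) (var 4))) = N.
  rewrite /N -(denE s) // -(eval_gain sm si sj) -(eval_num sm (vk _ sm si)).
  by [].
set s1 := update s 3 0 N; have s1m : loaded s1 by apply: loaded_update.
apply: wp_assign => //.
have -> : eval s1 (EMul (var 4) (EMul (den mat_expr) (den v))) = D.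
  by rewrite /D -(denE s1).
apply: Qs fr; first exact: loaded_update.
by move=> a /negPf a3 /negPf a4; rewrite /s1 /update a3 a4.
Qed.

Definition opt_term (i j : nat) : rat :=
  gain i j * rat_at (if 0 < gain i j then up_at i else lo_at i).
Definition opt_value (j : nat) : rat := \sum_(0 <= i < n1) opt_term i j.

Lemma wp_opt_sum s (j : nat) (Q : store -> seq int -> Prop) :
  loaded s -> s 2%N 0%N = j -> (j < n2)%N -> s 3%N 0%N = 0 -> s 4%N 0%N = 1 ->
  (forall s', loaded s' -> s' 2%N 0%N = j ->
     (forall a, (4 < a)%N -> s' a 0%N = s a 0%N) ->
     frac L (opt_value j) (s' 3%N 0%N) (s' 4%N 0%N) -> Q s' [::]) ->
  wp L (CFor 1 nrow_expr (CIf gain_expr (accum up_expr) (accum lo_expr))) s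
    (n1 * 5 + 2) Q.
Proof.
move=> sm sj j_lt s3 s4 Qs.
(* A summand has [S + S] bits, so the unreduced sum after [i] rows has at most [(S + S).+1 * i]. *)
pose I (i : nat) s' (o : seq int) := [/\ loaded s', s' 1%N 0%N = i, s' 2%N 0%N = j /\ o = [::],
  forall a, (4 < a)%N -> s' a 0%N = s a 0%N
  & frac ((S + S).+1 * i) (\sum_(0 <= k < i) opt_term k j) (s' 3%N 0%N) (s' 4%N 0%N)].
apply: (@wp_weaken _ _ _ (n1 * 5 + 2) _ (I n1)) =>
  [||s' o [s'm s'i [s'j ->] s's fr]] //; last first.
  by apply: Qs => //; apply: frac_weaken fr; apply: acc_le_L.
apply: (wp_for L_gt0 (I := I)) => //; first by case: sm.
- by move=> i s' o [s'm s'i _ _ _]; split=> //; [case: s'm|apply: eval_nrow].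
- split=> //; first exact: loaded_update.
    by move=> a a4; rewrite /update gtn_eqF // (ltn_trans _ a4).
  by rewrite muln0 big_geq // /update /= s3 s4; split.
move=> i s' o i_lt [s'm s'i [s'j ->] s's fr].
have iL : ((S + S).+1 + (S + S).+1 * i <= L)%N.
  by rewrite -mulnS acc_le_L // (leq_trans i_lt).
have step v k : (k = if 0 < gain i j then up_at i else lo_at i) ->
    (forall s1, loaded s1 -> s1 1%N 0%N = i -> eval s1 v = k) ->
    wp L (accum v) s' 2 (fun s1 o' =>
      bounded L s1 /\ I i.+1 (update s1 1 0 (s1 1%N 0%N + 1)) ([::] ++ o')).
  move=> kE vk; apply: (wp_accum s'm s'i s'j i_lt j_lt vk _ fr iL).
    by rewrite kE; case: ifP => _; [apply: up_den|apply: lo_den].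
  move=> s1 s1m s1s fr1; split; first by case: s1m.
  have -> : s1 1%N 0%N + 1 = i.+1 by rewrite s1s // s'i; lia.
  split=> //.
  - by apply: loaded_update => //; apply: index_le_L; apply: leq_trans i_lt n1S.
  - by rewrite /update /= s1s.
  - by move=> a a4; rewrite /update gtn_eqF 1?(ltn_trans _ a4) //= s1s ?s's // gtn_eqF // ltnW.
  - by rewrite mulnS big_nat_recr //= /opt_term -kE.
apply: (wp_if L_gt0); first by case: s'm.
- rewrite (eval_gain s'm s'i s'j) -(frac_gt0 (frac_gain i_lt j_lt)) => g0.
  by apply: (step _ (up_at i)); rewrite ?g0 // => s1 s1m; apply: eval_up.
- rewrite (eval_gain s'm s'i s'j) leNgt -(frac_gt0 (frac_gain i_lt j_lt)) => g0.
  by apply: (step _ (lo_at i)); rewrite ?(negPf g0) // => s1 s1m; apply: eval_lo.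
Qed.


Lemma wp_opt_search s : loaded s -> s 5%N 0%N = -1 -> s 6%N 0%N = 0 ->
  wp L opt_search s (n2 * (1 + (1 + ((n1 * 5 + 2) + 4))).+2 + 2) (fun s' o =>
    [/\ loaded s', o = [::]
      & best predT opt_value n2 (s' 5%N 0%N) (s' 6%N 0%N) (s' 7%N 0%N)]).
Proof.
move=> sm s5 s6.
pose I (j : nat) s' (o : seq int) := [/\ loaded s', s' 2%N 0%N = j, o = [::]
  & best predT opt_value j (s' 5%N 0%N) (s' 6%N 0%N) (s' 7%N 0%N)].
apply: (@wp_weaken _ _ _ (n2 * (1 + (1 + ((n1 * 5 + 2) + 4))).+2 + 2) _ (I n2)) => //;
  last by move=> s' o [].
apply: (wp_for L_gt0 (I := I)) => //; first by case: sm.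
- by move=> j s' o [s'm s'j _ _]; split=> //; [case: s'm|apply: eval_ncol].
- by split=> //; [exact: loaded_update|left; split].
move=> j s0 o j_lt [s0m s0j -> bst].
apply: wp_seq; apply: wp_assign => //=.
set s1 := update s0 3 0 0; have s1m : loaded s1 by apply: loaded_update.
apply: wp_seq; apply: wp_assign => //=.
set s2 := update s1 4 0 1.
have s2m : loaded s2 by apply: loaded_update; rewrite // expn_gt0.
apply: wp_seq; apply: (wp_opt_sum s2m _ j_lt) => // s3 s3m s3j s3s fr.
have next s' : loaded s' -> s' 2%N 0%N = j ->
    best predT opt_value j.+1 (s' 5%N 0%N) (s' 6%N 0%N) (s' 7%N 0%N) ->
    bounded L s' /\ I j.+1 (update s' 2 0 (s' 2%N 0%N + 1)) [::].
  move=> s'm s'j bst'; have -> : s' 2%N 0%N + 1 = j.+1 by rewrite s'j; lia.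
  split; first by case: s'm.
  split=> //; apply: loaded_update => //.
  by apply: index_le_L; apply: leq_trans j_lt n2S.
have [s35 s36 s37] : [/\ s3 5%N 0%N = s0 5%N 0%N, s3 6%N 0%N = s0 6%N 0%N
    & s3 7%N 0%N = s0 7%N 0%N] by rewrite !s3s.
have [_ _ NL DL] := fr.
apply: (wp_if L_gt0); rewrite /= ?s35 ?s36; first by case: s3m.
- move=> gt; rewrite -[3%N]/(1 + (1 + 1))%N.
  apply: wp_seq; apply: wp_assign => //=.
  set s4 := update s3 5 0 _; have s4m : loaded s4 by apply: loaded_update.
  apply: wp_seq; apply: wp_assign => //=.
  set s5' := update s4 6 0 _; have s5m : loaded s5' by apply: loaded_update.
  apply: wp_assign => //; apply: next => //=.
    apply: loaded_update => //=; rewrite /s5' /s4 /update /= s3j.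
    by apply: index_le_L; apply: leq_trans (ltnW j_lt) n2S.
  rewrite /s5' /s4 /update /= s3j.
  by apply: (best_update _ fr bst).
- move=> le; apply: wp_skip; apply: next => //.
  by rewrite s35 s36 s37; apply: (best_keep fr bst).
Qed.

(** For printing loops: [J] is insensitive to the counter and each round prints a function of the
    index, so no indexed invariant is needed at the call sites. *)
Lemma wp_for_out v e c s k (n : nat) (J : store -> Prop) (g : nat -> seq int) :
  (0 < v)%N -> (n <= S)%N -> J s -> (forall s, J s -> loaded s /\ eval s e = n) ->
  (forall s z, J s -> (`|z| <= 2 ^ L)%N -> J (update s v 0 z)) ->
  (forall i s, (i < n)%N -> J s -> s v 0%N = i ->
     wp L c s k (fun s' o => [/\ J s', s' v 0%N = i & o = g i])) ->
  wp L (CFor v e c) s (n * k.+2 + 2)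
    (fun s' o => J s' /\ o = flatten [seq g i | i <- iota 0 n]).
Proof.
move=> v0 nS Js Je Ju Jc.
pose I (i : nat) s' (o : seq int) := [/\ J s', s' v 0%N = i
  & o = flatten [seq g i | i <- iota 0 i]].
apply: (@wp_weaken _ _ _ (n * k.+2 + 2) _ (I n)) => //; last by move=> s' o [].
apply: (wp_for L_gt0 (I := I)) => //; first by case: (Je _ Js) => -[].
- by move=> i s' o [/Je[[s'L _] en] s'i _].
- by split; [exact: Ju|rewrite /update !eqxx|].
move=> i s' o i_lt [Js' s'i ->].
apply: wp_weaken (Jc _ _ i_lt Js' s'i) _ _ => // s2 o2 [Js2 s2i ->].
split; first by case: (Je _ Js2) => -[].
have -> : s2 v 0%N + 1 = i.+1 by rewrite s2i; lia.
split; rewrite /update ?eqxx //.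
  by apply: Ju => //; apply: index_le_L; apply: leq_trans i_lt nS.
by rewrite -[i.+1]addn1 iotaD map_cat flatten_cat /= cats0.
Qed.

Definition rat_codes (k : nat) : seq int := [:: nth 0 x k; nth 0 x k.+1].

Lemma wp_emit_rat s v (k : nat) (Q : store -> seq int -> Prop) :
  loaded s -> eval s v = k -> Q s (rat_codes k) -> wp L (emit_rat v) s 2 Q.
Proof.
move=> sm vk Qs; have [sL _] := sm.
rewrite -[2%N]/(1 + 1)%N; apply: wp_seq; apply: (wp_emit L_gt0) => //.
by apply: (wp_emit L_gt0) => //; rewrite (eval_num sm vk) (eval_den sm vk).
Qed.

Definition opt_codes (b i j : nat) : seq int :=
  if j == b then rat_codes (if 0 < gain i j then up_at i else lo_at i)
  else [:: 0; 1].

Lemma wp_opt_output s (b : nat) : loaded s -> s 7%N 0%N = b ->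
  wp L opt_output s (n1 * (n2 * 6 + 2).+2 + 2) (fun _ o =>
    o = flatten [seq flatten [seq opt_codes b i j | j <- iota 0 n2] | i <- iota 0 n1]).
Proof.
move=> sm sb; pose J s' := loaded s' /\ s' 7%N 0%N = b.
apply: (@wp_weaken _ _ _ (n1 * (n2 * 6 + 2).+2 + 2) _ (fun s' o => J s' /\ o =
  flatten [seq flatten [seq opt_codes b i j | j <- iota 0 n2] | i <- iota 0 n1])) => //;
  last by move=> s' o [].
apply: wp_for_out => //.
- by move=> s' [s'm _]; split=> //; apply: eval_nrow.
- by move=> s' z [s'm s'b] zL; split=> //; apply: loaded_update.
move=> i s1 i_lt [s1m s1b] s1i.
pose J1 s' := J s' /\ s' 1%N 0%N = i.
apply: (@wp_weaken _ _ _ (n2 * 6 + 2) _ (fun s' o => J1 s' /\ o =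
  flatten [seq opt_codes b i j | j <- iota 0 n2])) => //;
  last by move=> s' o [[Js' s'i] ->].
apply: wp_for_out => //.
- by move=> s' [[s'm _] _]; split=> //; apply: eval_ncol.
- by move=> s' z [[s'm s'b] s'i] zL; split=> //; split=> //; apply: loaded_update.
move=> j s2 j_lt [[s2m s2b] s2i] s2j.
have [s2L _] := s2m.
apply: (wp_if L_gt0) => //.
- rewrite (eval_equal (a := j) (b := b)) // => jb.
  apply: (wp_if L_gt0) => //.
  + rewrite (eval_gain s2m s2i s2j) -(frac_gt0 (frac_gain i_lt j_lt)) => g0.
    apply: (@wp_emit_rat _ _ (up_at i)) => //; first exact: eval_up.
    by split=> //; rewrite /opt_codes jb g0.
  + rewrite (eval_gain s2m s2i s2j) leNgt -(frac_gt0 (frac_gain i_lt j_lt)) => g0.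
    apply: (@wp_emit_rat _ _ (lo_at i)) => //; first exact: eval_lo.
    by split=> //; rewrite /opt_codes jb (negPf g0).
- rewrite leNgt (eval_equal (a := j) (b := b)) // => jb.
  apply: (@wp_weaken _ _ _ (1 + 1) _ (fun s' o => [/\ J1 s', s' 2%N 0%N = j
    & o = opt_codes b i j])) => //.
  apply: wp_seq; apply: (wp_emit L_gt0) => //.
  by apply: (wp_emit L_gt0) => //=; split=> //; rewrite /opt_codes (negPf jb).
Qed.

Lemma wp_opt_prog s : loaded s -> s 6%N 0%N = 0 ->
  wp L opt_prog s (50 * S ^ 2) (fun _ o => exists b, [/\ (b < n2)%N,
    forall j, (j < n2)%N -> opt_value j <= opt_value b
    & o = flatten [seq flatten [seq opt_codes b i j | j <- iota 0 n2] | i <- iota 0 n1]]).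
Proof.
move=> sm s6.
pose k1 := (n2 * (1 + (1 + ((n1 * 5 + 2) + 4))).+2 + 2)%N.
pose k2 := (n1 * (n2 * 6 + 2).+2 + 2)%N.
apply: (@wp_weaken _ _ _ (1 + (k1 + k2))) => [||s' o Q]; last exact: Q.
  apply: wp_seq; apply: wp_assign => //.
  apply: wp_seq; apply: wp_weaken (wp_opt_search _ _ _) _ _ => //.
    by apply: loaded_update; rewrite // expn_gt0.
  (* Every column is a candidate and there is one, so the maximum is not the initial pair. *)
  move=> s1 o1 [s1m -> [[_ _ /(_ 0%N n2_gt0)//]|[b s1b [b_lt _ _ _ bmax]]]].
  apply: wp_weaken (wp_opt_output s1m s1b) _ _ => // s2 o2 ->.
  by exists b; split=> // j j_lt; apply: bmax.
(* As [n1] and [n2] lie between 1 and [S], the count is at most [30 * S ^ 2]; the constant 50 is not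
   sharp. *)
by rewrite /k1 /k2 -mulnn; nia.
Qed.


(** * Correctness of the separation program *)

Section Separation.
Variables (v : expr) (w_at : nat -> nat).
Hypothesis eval_v : forall s (i : nat), loaded s -> s 1%N 0%N = i -> eval s v = w_at i.
Hypothesis w_den : forall i, (i < n1)%N -> 0 < nth 0 x (w_at i).+1.

Definition weighted (i : nat) : bool := 0 < nth 0 x (w_at i).
Definition wratio (i j : nat) : rat := gain i j * (rat_at (w_at i))^-1.

Definition ratio_N (i j : nat) : int := sg * nth 0 x (mat_at i j) * nth 0 x (w_at i).+1.
Definition ratio_D (i j : nat) : int := nth 0 x (mat_at i j).+1 * nth 0 x (w_at i).

Lemma eval_ratio_num s (i j : nat) : loaded s -> s 1%N 0%N = i -> s 2%N 0%N = j ->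
  eval s (ratio_num v) = ratio_N i j.
Proof.
by move=> sm si sj; rewrite /ratio_N -(eval_gain sm si sj) -(eval_den sm (eval_v sm si)).
Qed.

Lemma eval_ratio_den s (i j : nat) : loaded s -> s 1%N 0%N = i -> s 2%N 0%N = j ->
  eval s (ratio_den v) = ratio_D i j.
Proof.
move=> sm si sj.
by rewrite /ratio_D -(eval_den sm (eval_mat sm si sj)) -(eval_num sm (eval_v sm si)).
Qed.

Lemma frac_ratio (i j : nat) : (i < n1)%N -> (j < n2)%N -> weighted i ->
  frac (S + S) (wratio i j) (ratio_N i j) (ratio_D i j).
Proof.
move=> i_lt j_lt wi; apply: frac_mul; first exact: frac_gain.
by apply: frac_inv wi _; exact/frac_at/w_den.
Qed.

Lemma wp_sep_column s (j : nat) (Q : store -> seq int -> Prop) :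
  loaded s -> s 2%N 0%N = j -> (j < n2)%N -> s 5%N 0%N = -1 -> s 6%N 0%N = 0 ->
  (forall s', loaded s' -> s' 2%N 0%N = j -> s' 3%N 0%N = s 3%N 0%N ->
     s' 4%N 0%N = s 4%N 0%N -> (forall k, k != j -> s' 7%N k = s 7%N k) ->
     best weighted (wratio^~ j) n1 (s' 5%N 0%N) (s' 6%N 0%N) (s' 7%N j) ->
     (`|s' 5%N 0%N| <= 2 ^ (S + S))%N -> (`|s' 6%N 0%N| <= 2 ^ (S + S))%N ->
     Q s' [::]) ->
  wp L (sep_column v) s (n1 * 7 + 2) Q.
Proof.
move=> sm sj j_lt s5 s6 Qs.
pose K s' := [/\ loaded s', s' 2%N 0%N = j, s' 3%N 0%N = s 3%N 0%N /\
  s' 4%N 0%N = s 4%N 0%N, forall k, k != j -> s' 7%N k = s 7%N k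
  & (`|s' 5%N 0%N| <= 2 ^ (S + S))%N /\ (`|s' 6%N 0%N| <= 2 ^ (S + S))%N].
pose I (i : nat) s' (o : seq int) := [/\ K s', s' 1%N 0%N = i, o = [::]
  & best weighted (wratio^~ j) i (s' 5%N 0%N) (s' 6%N 0%N) (s' 7%N j)].
apply: (@wp_weaken _ _ _ (n1 * 7 + 2) _ (I n1)) => //; last first.
  by move=> s' o [[s'm s'j [s'3 s'4] s'7 [s'5 s'6]] _ -> bst]; apply: Qs.
apply: (wp_for L_gt0 (I := I)) => //; first by case: sm.
- by move=> i s' o [[s'm _ _ _ _] s'i _ _]; split=> //; [case: s'm|apply: eval_nrow].
- split=> //; last by left; split.
  split=> //; first exact: loaded_update.
  by rewrite /update /= s5 s6 expn_gt0.
move=> i s1 o i_lt [Ks1 s1i -> bst].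
have [s1m s1j [s13 s14] s17 [s15 s16]] := Ks1; have [s1L _] := s1m.
have i_le : (`|Posz i| <= 2 ^ L)%N.
  by apply: index_le_L; apply: leq_trans (ltnW i_lt) n1S.
have next s' : K s' -> s' 1%N 0%N = i ->
    best weighted (wratio^~ j) i.+1 (s' 5%N 0%N) (s' 6%N 0%N) (s' 7%N j) ->
    bounded L s' /\ I i.+1 (update s' 1 0 (s' 1%N 0%N + 1)) [::].
  move=> [s'm s'j [s'3 s'4] s'7 [s'5 s'6]] s'i bst'.
  have -> : s' 1%N 0%N + 1 = i.+1 by rewrite s'i; lia.
  split; first by case: s'm.
  split=> //; split=> //; apply: loaded_update => //.
  by apply: index_le_L; apply: leq_trans i_lt n1S.
apply: (wp_if L_gt0) => //; rewrite (eval_num s1m (eval_v s1m s1i)) => wi; last first.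
  apply: wp_skip; apply: next => //; apply: best_skip => //.
  by rewrite /weighted -leNgt.
have fr := frac_ratio i_lt j_lt wi; have [_ _ NS DS] := fr.
have [_ _ NL DL] := frac_weaken SS_le_L fr.
have evalE s' : loaded s' -> s' 1%N 0%N = i -> s' 2%N 0%N = j ->
    eval s' (ratio_num v) = ratio_N i j /\ eval s' (ratio_den v) = ratio_D i j.
  by move=> *; split; [apply: eval_ratio_num|apply: eval_ratio_den].
have [s1N s1D] := evalE _ s1m s1i s1j.
have cmpE : eval s1 (ESub (EMul (ratio_num v) (var 6)) (EMul (var 5) (ratio_den v))) =
    ratio_N i j * s1 6%N 0%N - s1 5%N 0%N * ratio_D i j by rewrite -s1N -s1D.
apply: (wp_if L_gt0) => //; rewrite cmpE => cmp; last first.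
  by apply: wp_skip; apply: next => //; apply: (best_keep (f := wratio^~ j) fr).
apply: (@wp_weaken _ _ _ (1 + (1 + 1)) _ (fun s' o' =>
  bounded L s' /\ I i.+1 (update s' 1 0 (s' 1%N 0%N + 1)) o')) => //.
apply: wp_seq; apply: (wp_set L_gt0) => //=; rewrite s1i s1j /=.
set s2 := update s1 7 j i; have s2m : loaded s2 by apply: loaded_update.
have [s2N s2D] := evalE s2 s2m s1i s1j.
apply: wp_seq; apply: wp_assign => //; rewrite s2N.
set s3 := update s2 5 0 (ratio_N i j); have s3m : loaded s3 by apply: loaded_update.
have [s3N s3D] := evalE s3 s3m s1i s1j.
apply: wp_assign => //; rewrite s3D; apply: next => //.
- split=> //; first exact: loaded_update.
  by move=> k /negPf kj; rewrite /s3 /s2 /update /= kj s17 // kj.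
- rewrite /s3 /s2 /update /= eqxx.
  exact: (best_update (f := wratio^~ j) wi fr bst).
Qed.

Definition best_row (i j : nat) : Prop :=
  [/\ (i < n1)%N, weighted i
    & forall k, (k < n1)%N -> weighted k -> wratio k j <= wratio i j].

Definition no_weight : Prop := forall i, (i < n1)%N -> ~~ weighted i.

Definition best_rows (s : store) (n : nat) (q : rat) : Prop :=
  exists p : nat -> nat, (forall j, (j < n)%N -> s 7%N j = p j /\ best_row (p j) j) /\
    q = \sum_(0 <= j < n) wratio (p j) j.

(** Eligibility of a row does not depend on the column: either every column has a candidate or none
    has, which are the two cases of the conclusion. *)
Lemma wp_sep_search s : loaded s -> s 3%N 0%N = 0 ->
  wp L (sep_search v) s
    (1 + (n2 * (1 + (1 + ((n1 * 7 + 2) + (1 + 1)))).+2 + 2)) (fun s' o =>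
    [/\ loaded s', o = [::]
      & no_weight /\ s' 4%N 0%N = 0 \/
        exists2 q, frac L q (s' 3%N 0%N) (s' 4%N 0%N) & best_rows s' n2 q]).
Proof.
move=> sm s3.
pose B j := ((S + S).+1 * j)%N.
(* Before the first column the denominator is still 1, hence the guard [0 < j]. The size bounds
   stand apart from [frac] because they must also hold when the denominator is 0. *)
pose I (j : nat) s' (o : seq int) := [/\ loaded s', s' 2%N 0%N = j, o = [::],
   (`|s' 3%N 0%N| <= 2 ^ B j)%N /\ (`|s' 4%N 0%N| <= 2 ^ B j)%N
 & no_weight /\ ((0 < j)%N -> s' 4%N 0%N = 0) \/
   exists2 q, frac (B j) q (s' 3%N 0%N) (s' 4%N 0%N) & best_rows s' j q].
apply: wp_seq; apply: wp_assign => //=.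
set s0 := update s 4 0 1; have s0m : loaded s0 by apply: loaded_update; rewrite ?expn_gt0.
pose k := (1 + (1 + ((n1 * 7 + 2) + (1 + 1))))%N.
apply: (@wp_weaken _ _ _ (n2 * k.+2 + 2) _ (I n2)) => //; last first.
  move=> s' o [s'm s'j -> _ h]; split=> //.
  case: h => [[nw s'4]|[q fr br]]; [left|right]; first by split=> //; apply: s'4.
  by exists q => //; apply: frac_weaken fr; apply: acc_le_L.
apply: (wp_for L_gt0 (I := I)); first by case: s0m.
- by move=> j s' o [s'm s'j _ _]; split=> //; [case: s'm|apply: eval_ncol].
- split=> //; first exact: loaded_update.
    by rewrite /s0 /update /= s3 expn_gt0.
  right; exists 0; first by split; rewrite /s0 /update /= ?s3 ?expn_gt0 // mul0r.
  by exists id; split=> //; rewrite big_geq.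
move=> j s1 o j_lt [s1m s1j -> [s1N s1D] br].
apply: wp_seq; apply: wp_assign => //=.
set s2 := update s1 5 0 (-1); have s2m : loaded s2 by apply: loaded_update; rewrite ?expn_gt0.
apply: wp_seq; apply: wp_assign => //=.
set s3' := update s2 6 0 0; have s3m : loaded s3' by apply: loaded_update.
apply: wp_seq; apply: (wp_sep_column (j := j) s3m) => //.
move=> s4 s4m s4j s43 s44 s47 bst s45 s46.
rewrite /s3' /s2 /update /= in s43 s44 s47.
have BS : B j.+1 = ((S + S).+1 + B j)%N by rewrite /B mulnS.
have BL : (B j.+1 <= L)%N by apply: acc_le_L; apply: leq_trans j_lt n2S.
rewrite -s43 -s44 in s1N s1D br.
have NB := absz_mulD_le s1N s1D s45 s46; rewrite -BS in NB.
have DB : (`|(s4 4%N 0%N * s4 6%N 0%N)%R| <= 2 ^ B j.+1)%N.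
  rewrite abszM BS addSn expnS expnD mulnC (leq_trans (leq_mul s46 s1D)) //.
  by rewrite leq_pmull.
apply: wp_seq; apply: wp_assign => //=.
set s5 := update s4 3 0 _.
have s5m : loaded s5 by apply: loaded_update => //; apply: le_pow_L NB BL.
apply: wp_assign => //=.
set s6 := update s5 4 0 _.
have s6m : loaded s6 by apply: loaded_update => //; apply: le_pow_L DB BL.
split; first by case: s6m.
have -> : s6 2%N 0%N + 1 = j.+1 by rewrite /s6 /s5 /update /= s4j; lia.
split=> //.
  apply: loaded_update => //.
  by apply: index_le_L; apply: leq_trans j_lt n2S.
rewrite /s6 /s5 /update /=.
case: bst => [[_ s460 nw]|[b s4b [b_lt wb D0 bE bmax]]].
  by left; split=> // _; rewrite s460 mulr0.
case: br => [[nw _]|[q fr [p [pbest qE]]]]; first by rewrite (negPf (nw _ b_lt)) in wb.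
right; exists (q + wratio b j).
  by rewrite BS; apply: frac_add fr _; split.
exists (fun k => if k == j then b else p k); split.
  move=> k'; rewrite ltnS leq_eqVlt; have [->|ne] := eqVneq k' j.
    by move=> _; split=> //; split.
  by rewrite /= => /pbest[<- ?]; rewrite s47.
rewrite big_nat_recr //= eqxx qE; congr (_ + _).
by apply: eq_big_nat => k' /andP[_ k'j]; rewrite ltn_eqF.
Qed.

Definition row_codes (p : nat -> nat) (i : nat) : seq int :=
  if weighted i then [seq ((p j == i)%:R : int) | j <- iota 0 n2] else [::].

Lemma wp_sep_output s p : loaded s -> (forall j, (j < n2)%N -> s 7%N j = Posz (p j)) ->
  wp L (sep_output v) s (n1 * (n2 * 4 + 2).+3 + 2)
    (fun _ o => o = flatten [seq row_codes p i | i <- iota 0 n1]).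
Proof.
move=> sm sp; pose J s' := loaded s' /\ forall j, (j < n2)%N -> s' 7%N j = Posz (p j).
apply: (@wp_weaken _ _ _ (n1 * (n2 * 4 + 2).+3 + 2) _ (fun s' o => J s' /\ o =
  flatten [seq row_codes p i | i <- iota 0 n1])) => //; last by move=> s' o [].
apply: wp_for_out => //.
- by move=> s' [s'm _]; split=> //; apply: eval_nrow.
- by move=> s' z [s'm s'p] zL; split=> //; apply: loaded_update.
move=> i s1 i_lt [s1m s1p] s1i; have [s1L _] := s1m.
apply: (wp_if L_gt0) => //; rewrite (eval_num s1m (eval_v s1m s1i)) => wi; last first.
  rewrite addn2; apply: wp_skip; split=> //.
  by rewrite /row_codes /weighted ltNge wi.
pose J1 s' := J s' /\ s' 1%N 0%N = i.
apply: (@wp_weaken _ _ _ (n2 * 4 + 2) _ (fun s' o => J1 s' /\ o =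
  flatten [seq [:: ((p j == i)%:R : int)] | j <- iota 0 n2])) => //; last first.
  move=> s' o [[Js' s'i] ->]; split=> //.
  by rewrite /row_codes /weighted wi -[RHS]flatten_seq1 -map_comp.
apply: wp_for_out => //.
- by move=> s' [[s'm _] _]; split=> //; apply: eval_ncol.
- by move=> s' z [[s'm s'p] s'i] zL; split=> //; split=> //; apply: loaded_update.
move=> j s2 j_lt [[s2m s2p] s2i] s2j; have [s2L _] := s2m.
have cmpE : (0 < eval s2 (equal_expr (EGet 7 (var 2)) (var 1))) = (p j == i).
  by apply: eval_equal => //=; rewrite s2j s2p.
apply: (wp_if L_gt0) => //; rewrite ?leNgt cmpE => pji; apply: (wp_emit L_gt0) => //.
  by rewrite pji.
by rewrite (negPf pji).
Qed.

Lemma wp_sep_prog s : loaded s -> s 3%N 0%N = 0 ->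
  wp L (sep_prog v) s (60 * S ^ 2) (fun _ o =>
    (o = [:: 0] /\ forall f : nat -> nat,
      (forall j, (j < n2)%N -> (f j < n1)%N && weighted (f j)) ->
      \sum_(0 <= j < n2) wratio (f j) j <= sg%:~R) \/
    exists p : nat -> nat,
      [/\ forall j, (j < n2)%N -> (p j < n1)%N && weighted (p j),
          sg%:~R < \sum_(0 <= j < n2) wratio (p j) j
        & o = 1 :: flatten [seq row_codes p i | i <- iota 0 n1]]).
Proof.
move=> sm s3.
pose k1 := (1 + (n2 * (1 + (1 + ((n1 * 7 + 2) + (1 + 1)))).+2 + 2))%N.
pose k2 := (n1 * (n2 * 4 + 2).+3 + 2)%N.
set Q := fun _ => _.
apply: (@wp_weaken _ _ _ (k1 + (1 + k2).+2) _ Q) => //; last first.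
  by rewrite /k1 /k2 -mulnn; nia.
apply: wp_seq; apply: wp_weaken (wp_sep_search sm s3) _ _ => //.
move=> s1 o [s1m ->]; have [s1L _] := s1m.
case=> [[nw s14]|[q fr [p [pbest qE]]]].
  (* No row is eligible, so no choice function exists on the nonempty set of columns and the family
     holds vacuously. *)
  apply: (wp_if L_gt0) => //=; first by rewrite s14.
  move=> _; apply: (@wp_weaken _ _ _ 1 _ (fun s' o' => Q s' o')) => //.
  apply: (wp_emit L_gt0) => //; left; split=> // f fP.
  by case/andP: (fP _ n2_gt0) => /nw/negPf ->.
apply: (wp_if L_gt0) => //=; last by case: fr => D0 _ _ _; rewrite leNgt D0.
move=> _.
have sgfr : frac S sg%:~R sg 1.
  split=> //; first by rewrite divr1.
    by rewrite sg1 expn_gt0.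
  by rewrite expn_gt0.
have cmpE := frac_lt sgfr fr; rewrite mulr1 in cmpE.
apply: (wp_if L_gt0) => //=; rewrite ?leNgt -cmpE => sgq; last first.
  apply: (@wp_weaken _ _ _ 1 _ (fun s' o' => Q s' o')) => //.
  apply: (wp_emit L_gt0) => //; left; split=> // f fP.
  apply: le_trans (_ : q <= _); last by rewrite leNgt.
  rewrite qE !big_mkord; apply: ler_sum => j _.
  have [_ [_ _ pmax]] := pbest j (ltn_ord j).
  by case/andP: (fP j (ltn_ord j)) => fj wf; apply: pmax.
apply: wp_seq; apply: (wp_emit L_gt0) => //.
apply: wp_weaken (wp_sep_output s1m (fun j j_lt => (pbest j j_lt).1)) _ _ => //.
move=> s2 o2 ->; right; exists p; split=> //; last by rewrite -qE.
by move=> j /pbest[_ [-> ->]].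
Qed.

End Separation.

End Programs.

(** * Encoding of the data *)

Lemma nth_flatten_const (T : Type) (x0 : T) (c : nat) (ss : seq (seq T)) (i j : nat) :
  all (fun s => size s == c) ss -> (j < c)%N ->
  nth x0 (flatten ss) (i * c + j) = nth x0 (nth [::] ss i) j.
Proof.
move=> + j_lt; elim: ss i => [|s ss IH] [|i] /=; rewrite ?nth_nil //.
  by case/andP => /eqP sc _; rewrite nth_cat sc mul0n add0n j_lt.
case/andP => /eqP sc ssc; rewrite nth_cat sc mulSn -addnA ltnNge leq_addr /=.
by rewrite addKn IH.
Qed.

Lemma size_flatten_const (T : Type) (c : nat) (ss : seq (seq T)) :
  all (fun s => size s == c) ss -> size (flatten ss) = (size ss * c)%N.
Proof. by elim: ss => //= s ss IH /andP[/eqP sc /IH]; rewrite size_cat sc mulSn => ->. Qed.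

Lemma flatten_flatten (T : Type) (ss : seq (seq (seq T))) :
  flatten (flatten ss) = flatten [seq flatten s | s <- ss].
Proof. by elim: ss => //= s ss <-; rewrite flatten_cat. Qed.

Lemma map_enum_ord (T : Type) (n : nat) (f : nat -> T) :
  [seq f (val i) | i <- enum 'I_n] = [seq f k | k <- iota 0 n].
Proof. by rewrite -val_enum_ord -map_comp. Qed.

Lemma enc_mxE (m n : nat) (A : 'M[rat]_(m, n)) :
  enc_mx A = flatten [seq flatten [seq enc_rat (A i j) | j <- enum 'I_n] | i <- enum 'I_m].
Proof. by rewrite /enc_mx flatten_flatten -map_comp. Qed.

Lemma size_enc_mx (m n : nat) (A : 'M[rat]_(m, n)) : size (enc_mx A) = (2 * (m * n))%N.
Proof.
rewrite (size_flatten_const (c := 2)); last exact/all_allpairsP.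
by rewrite size_allpairs !size_enum_ord mulnC.
Qed.

Lemma nth_enc_mx (m n : nat) (A : 'M[rat]_(m, n)) (i : 'I_m) (j : 'I_n) :
  nth 0 (enc_mx A) (2 * (i * n + j)) = numq (A i j) /\
  nth 0 (enc_mx A) (2 * (i * n + j)).+1 = denq (A i j).
Proof.
have pairs : nth [::] [seq enc_rat (A i j) | i <- enum 'I_m, j <- enum 'I_n] (i * n + j) =
    enc_rat (A i j).
  rewrite nth_flatten_const //; last first.
    by apply/allP => s /mapP[k _ ->]; rewrite size_map size_enum_ord.
  rewrite (nth_map i) ?size_enum_ord // (nth_map j) ?size_enum_ord //.
  by rewrite !nth_ord_enum.
have sizes : all (fun s => size s == 2%N)
    [seq enc_rat (A i j) | i <- enum 'I_m, j <- enum 'I_n].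
  by apply/all_allpairsP.
have nthE k : (k < 2)%N -> nth 0 (enc_mx A) (2 * (i * n + j) + k) = nth 0 (enc_rat (A i j)) k.
  by move=> k_lt; rewrite mulnC nth_flatten_const // pairs.
by split; [rewrite -[X in nth _ _ X]addn0|rewrite -addn1]; rewrite nthE.
Qed.

(** A sign bit and at least one digit per integer. Applied to the encoded data, this bounds both
    dimensions by the input size. *)
Lemma size_le_input_size (x : seq int) : (2 * size x <= input_size x)%N.
Proof.
rewrite /input_size; elim: x => [|z x IH]; first by rewrite big_nil.
by rewrite big_cons mulnS leq_add.
Qed.

(** * Reading the encoded data *)

Section RowData.
Variable d : row_data.
Let x := enc_row_data d.
Let n1 := nrow d.
Let n2 := ncol d.
Let S := input_size x.

Lemma nth_row_mat (i : 'I_n1) (j : 'I_n2) :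
  nth 0 x (mat_at n1 n2 i j) = numq (row_mat d i j) /\
  nth 0 x (mat_at n1 n2 i j).+1 = denq (row_mat d i j).
Proof.
have matE k : nth 0 x (2 + 4 * n1 + k) = nth 0 (enc_mx (row_mat d)) k.
  have -> : (2 + 4 * n1 + k = (2 * (n1 * 1) + (2 * (n1 * 1) + k)).+2)%N by lia.
  rewrite /x /enc_row_data /= nth_cat size_enc_mx ltnNge leq_addr /= addKn.
  by rewrite nth_cat size_enc_mx ltnNge leq_addr /= addKn.
rewrite /mat_at -addnS !matE; exact: nth_enc_mx.
Qed.

Lemma nth_row_lo (i : 'I_n1) :
  nth 0 x (lo_at i) = numq (row_lo d i 0) /\
  nth 0 x (lo_at i).+1 = denq (row_lo d i 0).
Proof.
rewrite -[lo_at i]/(2 * i).+2 /x /enc_row_data /=.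
have [i0 i1] : (2 * i < 2 * (n1 * 1))%N /\ ((2 * i).+1 < 2 * (n1 * 1))%N.
  by have := ltn_ord i; lia.
rewrite !nth_cat !size_enc_mx i0 i1.
by have := nth_enc_mx (row_lo d) i 0; rewrite muln1 addn0.
Qed.

Lemma nth_row_up (i : 'I_n1) :
  nth 0 x (up_at n1 i) = numq (row_up d i 0) /\
  nth 0 x (up_at n1 i).+1 = denq (row_up d i 0).
Proof.
have -> : up_at n1 i = (2 * (n1 * 1) + 2 * i).+2 by rewrite /up_at /lo_at; lia.
rewrite /x /enc_row_data /= -addnS !nth_cat !size_enc_mx !ltnNge !leq_addr /= !addKn.
have [i0 i1] : (2 * i < 2 * (n1 * 1))%N /\ ((2 * i).+1 < 2 * (n1 * 1))%N.
  by have := ltn_ord i; lia.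
rewrite -!ltnNge i0 i1.
by have := nth_enc_mx (row_up d) i 0; rewrite muln1 addn0.
Qed.

Lemma rat_at_codes k (q : rat) : nth 0 x k = numq q /\ nth 0 x k.+1 = denq q ->
  rat_at x k = q /\ rat_codes x k = enc_rat q.
Proof. by rewrite /rat_at /rat_codes => -[-> ->]; rewrite divq_num_den. Qed.

Lemma size_enc_row_data : size x = (2 + 4 * n1 + 2 * (n1 * n2))%N.
Proof. by rewrite /x /enc_row_data /= !size_cat !size_enc_mx -/n1 -/n2; lia. Qed.

Lemma nth_le_input_size k : (`|nth 0%R x k| <= 2 ^ S)%N.
Proof.
have [k_lt|k_ge] := ltnP k (size x); last by rewrite nth_default.
apply: leq_trans (ltnW (absz_lt_bitsize _)) _; rewrite leq_exp2l //.
rewrite /S /input_size (big_nth 0) (bigD1_seq k) ?mem_index_iota ?iota_uniq //=.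
exact: leq_addr.
Qed.

Lemma loaded_init_store : loaded x S (init_store x).
Proof.
split=> // a i; rewrite /init_store; case: eqP => // _.
apply: leq_trans (nth_le_input_size _) _; rewrite leq_exp2l //.
by rewrite -mulnn; nia.
Qed.

Lemma lo_den_gt0 i : (i < n1)%N -> 0 < nth 0 x (lo_at i).+1.
Proof. by move=> i_lt; have [_ ->] := nth_row_lo (Ordinal i_lt); apply: denq_gt0. Qed.

Lemma up_den_gt0 i : (i < n1)%N -> 0 < nth 0 x (up_at n1 i).+1.
Proof. by move=> i_lt; have [_ ->] := nth_row_up (Ordinal i_lt); apply: denq_gt0. Qed.

Lemma mat_den_gt0 i j : (i < n1)%N -> (j < n2)%N -> 0 < nth 0 x (mat_at n1 n2 i j).+1.
Proof.
move=> i_lt j_lt; have [_ ->] := nth_row_mat (Ordinal i_lt) (Ordinal j_lt).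
exact: denq_gt0.
Qed.

End RowData.

(** * Optimality of a single column and the two complexity claims *)

Section ColumnOptimum.
Variables (R : realFieldType) (n1 n2 : nat) (l u : 'cV[R]_n1) (C : 'M[R]_(n1, n2)).
Hypothesis lu : row_bounds l u.

Definition col_choice (j : 'I_n2) (i : 'I_n1) : R :=
  if 0 < C i j then u i 0 else l i 0.

Definition col_value (j : 'I_n2) : R := \sum_i C i j * col_choice j i.

(** With a witness [t] for [V], the sign of [C i j] gives [C i j * V i j <= t 0 j * (C i j *
    col_choice j i)]; the objective is thus at most an average of the column values. *)
Lemma column_mx_optimum (b : 'I_n2) : (forall j, col_value j <= col_value b) ->
  let W := column_mx b (col_choice b) in
  Urow l u W /\ forall V, Urow l u V -> linfun_mx C V <= linfun_mx C W.
Proof.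
move=> bmax /=; split.
  apply: column_mx_Urow => // i; have /andP[_ lui] := lu i.
  by rewrite /col_choice; case: ifP; rewrite lexx lui.
move=> V /(Urow_row_ext (leq_ltn_trans (leq0n b) (ltn_ord b))) [t [t1 tV t0]].
have -> : linfun_mx C (column_mx b (col_choice b)) = col_value b.
  apply: eq_bigr => i _; rewrite (bigD1 b) //= big1 => [|j /negPf jb]; rewrite mxE.
    by rewrite eqxx addr0.
  by rewrite jb mulr0.
rewrite -[leRHS]mul1r -t1 mulr_suml /linfun_mx exchange_big /=.
apply: ler_sum => j _; apply: (@le_trans _ _ (t 0 j * col_value j)); last first.
  by rewrite ler_wpM2l.
rewrite /col_value mulr_sumr; apply: ler_sum => i _.
rewrite mulrCA; have /andP[lV Vu] := tV i j; rewrite /col_choice.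
case: ltrP => Cij; first by rewrite ler_wpM2l 1?mulrC // ltW.
by rewrite ler_wnM2l // mulrC.
Qed.

End ColumnOptimum.

Lemma linfun_mxZ (R : realFieldType) (m n : nat) (a : R) (C W : 'M[R]_(m, n)) :
  linfun_mx (a *: C) W = a * linfun_mx C W.
Proof.
rewrite /linfun_mx mulr_sumr; apply: eq_bigr => i _.
by rewrite mulr_sumr; apply: eq_bigr => j _; rewrite mxE mulrA.
Qed.

Lemma row_bounds_ratr (R : realFieldType) (n : nat) (l u : 'cV[rat]_n) : row_bounds l u ->
  row_bounds (map_mx (ratr : rat -> R) l) (map_mx (ratr : rat -> R) u).
Proof. by move=> lu i; rewrite !mxE ler0q ler_rat. Qed.

(** The program computes with rationals while optimality is claimed over [R]. The embedding [ratr]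
    preserves signs and order, so entries and comparisons of column values agree on both sides. *)
Lemma row_optimum_polytime (R : realFieldType) (maximize : bool) :
  polytime_solvable valid_row_data enc_row_data (row_optimum R maximize).
Proof.
pose sg : int := if maximize then 1 else -1.
apply: (@polytime_of_wp _ _ _ _ (opt_prog sg) 3 50) => d [n1_gt0 n2_gt0 lu] /=.
set x := enc_row_data d.
have sz := size_le_input_size x; rewrite size_enc_row_data in sz.
apply: wp_weaken (@wp_opt_prog sg _ x (nrow d) (ncol d) (input_size x)
  _ _ _ _ _ _ _ _ _ _ _ _ _) _ _ => //.
- by rewrite /sg; case: (maximize).
- exact: nth_le_input_size.
- exact: lo_den_gt0.
- exact: up_den_gt0.
- exact: mat_den_gt0.
- by nia.
- by nia.
- exact: loaded_init_store.
move=> s o [b [b_lt bmax ->]].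
pose Cq : 'M[rat]_(nrow d, ncol d) := sg%:~R *: row_mat d.
have gainE (i : 'I_(nrow d)) (j : 'I_(ncol d)) : gain sg x (nrow d) (ncol d) i j = Cq i j.
  by rewrite /gain (rat_at_codes (nth_row_mat i j)).1 mxE.
pose bo := Ordinal b_lt.
have choiceE (i : 'I_(nrow d)) (j : 'I_(ncol d)) :
    let k := if 0 < gain sg x (nrow d) (ncol d) i j then up_at (nrow d) i else lo_at i in
    rat_at x k = col_choice (row_lo d) (row_up d) Cq j i /\
    rat_codes x k = enc_rat (col_choice (row_lo d) (row_up d) Cq j i).
  rewrite /= gainE /col_choice; case: ifP => _; apply: rat_at_codes.
    exact: nth_row_up.
  exact: nth_row_lo.
have valueE (j : 'I_(ncol d)) : opt_value sg x (nrow d) (ncol d) j =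
    col_value (row_lo d) (row_up d) Cq j.
  rewrite /opt_value big_mkord; apply: eq_bigr => i _.
  by rewrite /opt_term (choiceE i j).1 gainE.
pose W := column_mx bo (col_choice (row_lo d) (row_up d) Cq bo).
exists W.
set lR := map_mx _ (row_lo d); set uR := map_mx _ (row_up d).
set CR := map_mx _ (row_mat d).
have choiceR j i : ratr (col_choice (row_lo d) (row_up d) Cq j i) =
    col_choice lR uR (sg%:~R *: CR) j i.
  rewrite /col_choice !mxE.
  have -> : sg%:~R * ratr (row_mat d i j) = ratr (sg%:~R * row_mat d i j) :> R.
    by rewrite rmorphM /= ratr_int.
  by rewrite ltr0q; case: ifP.
have WR : map_mx ratr W = column_mx bo (col_choice lR uR (sg%:~R *: CR) bo).
  apply/matrixP => i j; rewrite !mxE; case: eqP => _; last exact: rmorph0.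
  exact: choiceR.
have [] := @column_mx_optimum R _ _ lR uR (sg%:~R *: CR) _ bo.
- exact: row_bounds_ratr.
- move=> j; have := bmax j (ltn_ord j); rewrite -[b]/(val bo) !valueE -(ler_rat R).
  rewrite !rmorph_sum /=; congr (_ <= _); apply: eq_bigr => i _;
    by rewrite rmorphM /= choiceR !mxE rmorphM /= ratr_int.
move=> UW opt; rewrite WR; split=> //.
- move=> V /opt; rewrite !linfun_mxZ /sg.
  by case: (maximize); rewrite ?mul1r ?mulN1r ?lerN2.
- rewrite enc_mxE -map_enum_ord; congr flatten; apply: eq_map => i.
  rewrite -map_enum_ord; congr flatten; apply: eq_map => j.
  rewrite /opt_codes mxE -[b]/(val bo) val_eqE.
  by case: eqP => // ->; rewrite (choiceE i bo).2.
Qed.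

Definition fun_of_ord (m n : nat) (f : 'I_n -> 'I_m) (j : nat) : nat :=
  oapp (fun j' => val (f j')) 0%N (insub j).

Lemma fun_of_ordE (m n : nat) (f : 'I_n -> 'I_m) (j : 'I_n) : fun_of_ord f j = f j.
Proof. by rewrite /fun_of_ord valK. Qed.

Lemma flatten_map_if (T U : Type) (P : pred T) (g : T -> seq U) (s : seq T) :
  flatten [seq if P t then g t else [::] | t <- s] = flatten [seq g t | t <- s & P t].
Proof. by elim: s => //= t s ->; case: (P t). Qed.

(** Matches the order in which the program prints the positive rows with the numbering that indexes
    (b). *)
Lemma map_enum_val (T : finType) (A : {set T}) :
  [seq enum_val k | k <- enum 'I_#|A|] = enum A.
Proof.
case: (pickP (mem A)) => [x0 _|A0].
  rewrite -[RHS](mkseq_nth x0) -cardE /mkseq -map_enum_ord.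
  by apply: eq_map => k; apply: enum_val_nth.
have card0 : #|A| = 0%N by apply: eq_card0.
rewrite [LHS]size0nil; first by rewrite [RHS]size0nil // -cardE.
by rewrite size_map -cardE card_ord.
Qed.

(** The common core of both separation claims: [V] is the upper bound vector with sign 1 for (a),
    the lower bound vector with sign -1 for (b). *)
Lemma wp_sep_rows (d : row_data) (sg : int) (v : expr) (w_at : nat -> nat)
    (V : 'cV[rat]_(nrow d)) :
  let x := enc_row_data d in let S := input_size x in
  `|sg|%N = 1%N -> valid_row_data d ->
  (forall s (i : nat), loaded x S s -> s 1%N 0%N = i -> eval s v = w_at i) ->
  (forall i : 'I_(nrow d), nth 0 x (w_at i) = numq (V i 0) /\
     nth 0 x (w_at i).+1 = denq (V i 0)) ->
  wp (3 * S ^ 2) (sep_prog sg v) (init_store x) (60 * S ^ 2) (fun _ o =>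
    (o = [:: 0] /\ forall f : 'I_(ncol d) -> 'I_(nrow d), (forall j, 0 < V (f j) 0) ->
       \sum_j sg%:~R * (row_mat d (f j) j / V (f j) 0) <= sg%:~R) \/
    exists f : 'I_(ncol d) -> 'I_(nrow d), [/\ forall j, 0 < V (f j) 0,
       sg%:~R < \sum_j sg%:~R * (row_mat d (f j) j / V (f j) 0)
     & o = 1 :: [seq (f j == i)%:R | i <- enum (pos_rows V), j <- enum 'I_(ncol d)]]).
Proof.
move=> x S sg1 [n1_gt0 n2_gt0 lu] v_eval VE.
have sz := size_le_input_size x; rewrite size_enc_row_data in sz.
apply: wp_weaken (@wp_sep_prog sg sg1 x (nrow d) (ncol d) S
  _ _ _ _ _ _ _ _ v w_at _ _ _ _ _) _ _ => //.
- exact: nth_le_input_size.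
- exact: mat_den_gt0.
- by rewrite /S; nia.
- by rewrite /S; nia.
- by move=> i i_lt; have [_ ->] := VE (Ordinal i_lt); apply: denq_gt0.
- exact: loaded_init_store.
have weightedE (i : 'I_(nrow d)) : weighted x w_at i = (0 < V i 0).
  by rewrite /weighted (VE i).1 numq_gt0.
have ratioE (i : 'I_(nrow d)) (j : 'I_(ncol d)) :
    wratio sg x (nrow d) (ncol d) w_at i j = sg%:~R * (row_mat d i j / V i 0).
  by rewrite /wratio /gain (rat_at_codes (nth_row_mat i j)).1 (rat_at_codes (VE i)).1 mulrA.
move=> s o [[-> all_le]|[p [pP gt ->]]]; [left|right].
  split=> // f fV; have := all_le (fun_of_ord f); rewrite big_mkord.
  under eq_bigr do rewrite fun_of_ordE ratioE.
  apply=> j j_lt; rewrite -[j]/(val (Ordinal j_lt)) fun_of_ordE ltn_ord.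
  by rewrite weightedE fV.
have [f fp] : exists f : 'I_(ncol d) -> 'I_(nrow d), forall j, val (f j) = p j.
  apply: (@fin_all_exists _ _ (fun (j : 'I_(ncol d)) (k : 'I_(nrow d)) => val k = p j)) => j.
  by case/andP: (pP j (ltn_ord j)) => pj _; exists (Ordinal pj).
exists f; split.
- by move=> j; rewrite -weightedE fp; case/andP: (pP j (ltn_ord j)).
- move: gt; rewrite big_mkord; under eq_bigr do rewrite -fp ratioE.
  by [].
have -> : enum (pos_rows V) = [seq i <- enum 'I_(nrow d) | 0 < V i 0].
  rewrite {1}/enum_mem -enumT; apply: eq_filter => i.
  by rewrite -[LHS]/(i \in pos_rows V) inE.
congr (_ :: _); rewrite -map_enum_ord -[RHS]flatten_map_if; congr flatten.
apply: eq_map => i; rewrite /row_codes weightedE -map_enum_ord.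
by under eq_map do rewrite -fp val_eqE.
Qed.

Lemma separation_a_polytime :
  polytime_solvable valid_row_data_pos enc_row_data separation_a.
Proof.
apply: (@polytime_of_wp _ _ _ _ (sep_prog 1 up_expr) 3 60) => d [dv u_gt0].
apply: wp_weaken (@wp_sep_rows d 1 up_expr (up_at (nrow d)) (row_up d) _ dv _ _) _ _ => //.
- by move=> s i sm si; apply: (eval_up (x := enc_row_data d)) sm si.
- exact: nth_row_up.
move=> s o h; case: h => [[-> all_le]|[f [_ gt ->]]]; [left|right].
  split=> //; apply/all_ordered_partitions => f; rewrite ineq_a_fibers.
  by have := all_le f; under eq_bigr do rewrite mul1r; apply.
exists (fibers f); split; first exact: fibers_ordered_partition.
  rewrite ineq_a_fibers -ltNge; move: gt; under eq_bigr do rewrite mul1r.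
  by [].
congr (_ :: _); rewrite /enc_sets.
(* All upper bounds are positive, so no row is skipped in the output. *)
have -> : enum (pos_rows (row_up d)) = enum 'I_(nrow d).
  by apply: eq_enum => i; rewrite !inE u_gt0.
by apply: eq_allpairs => // i j; rewrite in_fibers.
Qed.

(** Negation turns a violation of (b) into a sum exceeding -1. If no row is positive, the columns
    cannot be covered by zero parts, and the answer 0 is correct. *)
Lemma separation_b_polytime :
  polytime_solvable valid_row_data_pos enc_row_data separation_b.
Proof.
apply: (@polytime_of_wp _ _ _ _ (sep_prog (-1) lo_expr) 3 60) => d [dv _].
apply: wp_weaken (@wp_sep_rows d (-1) lo_expr lo_at (row_lo d) _ dv _ _) _ _ => //.
- by move=> s i _; apply: eval_lo.
- exact: nth_row_lo.
have negE f : \sum_j (-1)%:~R * (row_mat d (f j) j / row_lo d (f j) 0) =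
    - \sum_j row_mat d (f j) j / row_lo d (f j) 0.
  by rewrite -sumrN; apply: eq_bigr => j _; rewrite mulN1r.
move=> s o h; case: h => [[-> all_le]|[f [fV gt ->]]]; [left|right].
  split=> //; apply/all_ordered_partitions => f; rewrite ineq_b_fibers.
  have := all_le (fun j => enum_val (f j)); rewrite negE lerN2; apply=> j.
  by have := enum_valP (f j); rewrite inE.
have [g fg] := enum_rank_pos_rows fV.
exists (fibers g); split; first exact: fibers_ordered_partition.
  rewrite ineq_b_fibers -ltNge; move: gt; rewrite negE ltrN2.
  by under [X in _ -> is_true (X < _)]eq_bigr do rewrite fg.
congr (_ :: _); rewrite /enc_sets -map_enum_val allpairs_mapl.
by apply: eq_allpairs => k j; rewrite in_fibers -fg (inj_eq enum_val_inj).
Qed.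

Theorem proposition2 (R : realType) :
  (* 1 *)
  (forall (n1 n2 : nat) (l u : 'cV[R]_n1), (0 < n1)%N -> (0 < n2)%N ->
     row_bounds l u ->
     polyhedral (conv (Urow l u : set 'M[R]_(n1, n2))))
  /\
  (* 2 *)
  [/\ forall (n1 n2 : nat) (l u : 'cV[R]_n1), (0 < n1)%N -> (0 < n2)%N ->
        row_bounds l u ->
        forall W : 'M[R]_(n1, n2),
          conv (Urow l u) W <-> exists t : 'rV[R]_n2, row_ext l u t W,
      forall (n1 n2 : nat) (l u : 'cV[R]_n1) (t : 'rV[R]_n2)
        (W : 'M[R]_(n1, n2)),
        satisfies (row_ext_system n2 l u) (ext_point t W) <-> row_ext l u t W,
      exists p : {poly {poly nat}}, forall (n1 n2 : nat) (l u : 'cV[R]_n1),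
        (system_size (row_ext_system n2 l u) <= p.[n1%:P].[n2])%N
    & forall maximize : bool,
        polytime_solvable valid_row_data enc_row_data (row_optimum R maximize)]
  /\
  (* 3 *)
  [/\ forall (n1 n2 : nat) (l u : 'cV[R]_n1), (0 < n1)%N -> (0 < n2)%N ->
        row_bounds l u -> (forall i, 0 < u i 0) ->
        forall W : 'M[R]_(n1, n2),
          conv (Urow l u) W <->
          [/\ forall T : {ffun 'I_n1 -> {set 'I_n2}},
                T \in ordered_partitions n1 [set: 'I_n2] ->
                ineq_a u W T,
              pos_rows l != finset.set0 ->
                forall T : {ffun 'I_#|pos_rows l| -> {set 'I_n2}},
                  T \in ordered_partitions #|pos_rows l| [set: 'I_n2] ->
                  ineq_b W T,
              forall (j : 'I_n2) (i1 i2 : 'I_n1), i1 \in pos_rows l ->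
                i1 != i2 -> l i1 0 * W i2 j <= u i2 0 * W i1 j
            & forall i j, 0 <= W i j],
      polytime_solvable valid_row_data_pos enc_row_data separation_a
    & polytime_solvable valid_row_data_pos enc_row_data separation_b].
Proof.
split; first by move=> n1 n2 l u n1_gt0 n2_gt0 lu; apply: polyhedral_conv_Urow.
split; split.
- by move=> n1 n2 l u _ n2_gt0 lu W; apply: conv_row_ext.
- by move=> *; apply: row_ext_systemP.
- exact: row_ext_system_size.
- exact: row_optimum_polytime.
- by move=> n1 n2 l u n1_gt0 n2_gt0 lu u_gt0 W; apply: conv_row_partitions.
- exact: separation_a_polytime.
- exact: separation_b_polytime.
Qed.
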